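(* Let $A=\mathbf{F}_q[t]$ with $q$ a prime power, and $K=\mathbf{F}_q(t)$. Let $f \in A[x_1,\dots,x_n]$ be a polynomial that is squarefree as an element of $K[x_1,\dots,x_n]$. Let $\mathcal S_f:=\{\, a\in A^n : f(a) \text{ is squarefree} \,\}$. For each nonzero prime $\mathfrak p \subseteq A$, let $c_{\mathfrak p}$ be the number of $x \in (A/\mathfrak p^2)^n$ satisfying $f(x)=0$ in $A/\mathfrak p^2$. Then $\mu(\mathcal S_f)$ exists and equals $\prod_{\mathfrak p} (1 - c_{\mathfrak p}/|\mathfrak p|^{2n})$, the product over all nonzero primes of $A$.
   Context: An element of $A$ is squarefree if it is not divisible by $\mathfrak p^2$ for any nonzero prime $\mathfrak p$. For nonzero $a\in A$, $|a|:=\#(A/aA)$, $|0|:=0$, and $|\mathfrak p|:=\#(A/\mathfrak p)$. For reals $B_1,\dots,B_n$, $\mathrm{Box}=\{(a_1,\dots,a_n)\in A^n:|a_i|\le B_i\ \forall i\}$, and for $\mathcal S\subseteq A^n$, $\mu(\mathcal S):=\lim_{B_1,\dots,B_n\to\infty}\#(\mathcal S\cap\mathrm{Box})/\#\mathrm{Box}$ with the $B_i$ tending to infinity independently. *)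

(* Defs.v *)
From HB Require Import structures.
From mathcomp Require Import all_boot all_order all_algebra finmap.
(* The notations of mpoly clash with those of mathcomp-analysis. *)
From mathcomp Require Import -(notations) mpoly.
From mathcomp Require Import all_classical all_reals all_analysis.
From mathcomp Require summability.

Set Implicit Arguments.
Unset Strict Implicit.
Unset Printing Implicit Defensive.

Import Order.TTheory GRing.Theory Num.Theory.
Import numFieldNormedType.Exports.
Local Open Scope classical_set_scope.
Local Open Scope ring_scope.

Notation "{ 'mpoly' R [ n ] }" := (mpoly.mpoly n R)
  (format "{ 'mpoly'  R [ n ] }") : type_scope.

Section Ideals.
Variable A : comNzRingType.
Implicit Types (I J : set A) (a : A).

(* [idealr_closed] includes properness (1 \notin I). *)
Definition nonzero_prime : set (set A) :=
  [set I : set A | [/\ idealr_closed (mem I), prime_idealr_closed (mem I)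
                     & I != [set 0]]].

Definition principal_ideal a : set A := [set a * x | x in [set: A]].

Definition ideal_mul I J : set A :=
  [set a | exists s : seq (A * A),
     (forall u, u \in s -> I u.1 /\ J u.2) /\ a = \sum_(u <- s) u.1 * u.2].

Definition ideal_sqr I : set A := ideal_mul I I.

Definition coset_mod I a : set A := [set b | I (b - a)].

Definition quotient_set I : set (set A) := range (coset_mod I).

(* [fset_set] of an infinite set is empty, so this is #(A/I) only when A/I is
   finite. *)
Definition quotient_card I : nat := #|` fset_set (quotient_set I)|.

(* "P^2 divides a" is divisibility of the ideal aA by P^2, i.e. a \in P^2. *)
Definition ideal_squarefree a : Prop :=
  forall P, nonzero_prime P -> ~ ideal_sqr P a.

(* The zeros of f in (A/I)^n.  A point of (A/I)^n is a tuple of cosets, and the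
   value of f at it is the coset of f.@[a] for any tuple a of representatives. *)
Definition zeros_mod n (f : {mpoly A[n]}) I : set {ffun 'I_n -> set A} :=
  [set X | exists a : {ffun 'I_n -> A},
     (forall i, X i = coset_mod I (a i)) /\
     coset_mod I (meval a f) = coset_mod I 0].

Definition root_count n (f : {mpoly A[n]}) I : nat :=
  #|` fset_set (zeros_mod f I)|.

Definition abs_card a : nat :=
  if a == 0 then 0%N else quotient_card (principal_ideal a).

End Ideals.

(* For polynomials in several variables: no square of a nonunit divides x; in
   particular 0 is not squarefree. *)
Definition squarefree_elt (S : unitRingType) (x : S) : Prop :=
  forall g h : S, x = g ^+ 2 * h -> g \is a GRing.unit.

Section Density.
Variables (A : comNzRingType) (n : nat) (R : realType).

Definition box (B : 'I_n -> R) : set {ffun 'I_n -> A} :=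
  [set a | forall i, (abs_card (a i))%:R <= B i].

(* All the coordinates tend to +oo, independently of each other. *)
Definition all_pinfty : set_system ('I_n -> R) :=
  filter_from [set: R] (fun M => [set B | forall i, M <= B i]).

Definition has_density (S : set {ffun 'I_n -> A}) (mu : R) : Prop :=
  (fun B => #|` fset_set (S `&` box B)|%:R / #|` fset_set (box B)|%:R)
    @ all_pinfty --> mu.

End Density.

(* Unordered infinite product: limit of the finite partial products along the
   finite subsets of T directed by inclusion. *)
Definition has_product (R : realType) (T : choiceType) (u : T -> R) (l : R) :
  Prop := (fun s : {fset T} => \prod_(i <- s) u i) @ summability.totally --> l.

Definition squarefree_values (A : comNzRingType) n (f : {mpoly A[n]}) :
  set {ffun 'I_n -> A} := [set a | ideal_squarefree (meval a f)].

Definition local_factor (R : realType) (A : comNzRingType) n (f : {mpoly A[n]})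
    (P : set A) : R :=
  1 - (root_count f (ideal_sqr P))%:R / (quotient_card P)%:R ^+ (2 * n).

(* Main.v *)
(* Let pi be prime in A = F[t], q = #F, p = char F. By the Chinese remainder
   theorem the density of {a | pi^2 does not divide f(a) for all pi of degree at
   most M} is the finite product over these pi, so it suffices to show that the
   upper density of {a | pi^2 divides f(a) for some pi of degree > M} tends to 0
   with M.

   Write a_i = \sum_(j < p) t^j b_ij^p. The z_ij = b_ij^p are constants for
   d/dt, so if H(z) = f(\sum_j t^j z_ij) and DH is its coefficientwise
   derivative, then pi^2 | f(a) implies that pi divides both H(b^p) and
   DH(b^p). Since f is squarefree, H and DH have no common nonconstant prime
   factor g: such a g would divide Dg, whence Dg = 0; as g is a polynomial in the
   \sum_j t^j z_ij, its partial derivatives satisfy d_ij g = t^j d_i0 g, and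
   applying D kills them all, so that g would be a p-th power.

   It remains to bound the number of points of a box at which polynomials f_k
   without common factor are all divisible by a large prime. The variables are
   ordered so that the outermost one, x, has the longest range, say d. There is
   a nonzero combination h of the f_k free of x. For a prime pi that divides
   the value of h, either pi divides the values of all the coefficients of the
   f_k with respect to x, which is rare by induction, or the proportion of the x
   at which pi divides all the f_k is O(q^-(deg pi) + q^-d). Hence it suffices
   to bound the mean of min(1, \sum_(pi | h) q^-(deg pi)), which is done by a
   similar induction on leading coefficients. *)
Require Import Defs.
From HB Require Import structures.
From mathcomp Require Import all_boot all_order all_algebra finmap.
From mathcomp Require Import finfield ring lra zify.
From mathcomp Require Import -(notations) mpoly.
From mathcomp Require Import all_classical all_reals all_analysis.
Set Implicit Arguments.
Unset Strict Implicit.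
Unset Printing Implicit Defensive.
Import Order.TTheory GRing.Theory Num.Theory.
Import numFieldNormedType.Exports.
Local Open Scope classical_set_scope.
Local Open Scope ring_scope.

(** * Unique factorization in polynomial rings *)

Section Divisibility.
Variable S : idomainType.
Implicit Types (a b c p : S) (s : seq S).

Definition divides a b : Prop := exists c, b = c * a.

Definition prime_elt p : Prop :=
  [/\ p != 0, p \isn't a GRing.unit
    & forall a b, divides p (a * b) -> divides p a \/ divides p b].

Definition factored a : Prop :=
  exists s, exists2 u, u \is a GRing.unit &
    a = u * \prod_(p <- s) p /\ (forall p, p \in s -> prime_elt p).

Lemma divides_refl a : divides a a.
Proof. by exists 1; rewrite mul1r. Qed.

Lemma divides_trans a b c : divides a b -> divides b c -> divides a c.
Proof. by move=> [x ->] [y ->]; exists (y * x); rewrite mulrA. Qed.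

Lemma divides0 a : divides a 0.
Proof. by exists 0; rewrite mul0r. Qed.

Lemma dividesD a b c : divides a b -> divides a c -> divides a (b + c).
Proof. by move=> [x ->] [y ->]; exists (x + y); rewrite mulrDl. Qed.

Lemma dividesMl a b c : divides a c -> divides a (b * c).
Proof. by move=> [x ->]; exists (b * x); rewrite mulrA. Qed.

Lemma dividesMr a b c : divides a b -> divides a (b * c).
Proof. by rewrite mulrC; apply: dividesMl. Qed.

Lemma dividesB a b c : divides a b -> divides a c -> divides a (b - c).
Proof. by move=> ab [x ->]; rewrite -mulNr; apply: dividesD => //;
  exists (- x). Qed.

Lemma divides_sum (I : Type) (r : seq I) (P : pred I) (E : I -> S) a :
  (forall i, P i -> divides a (E i)) -> divides a (\sum_(i <- r | P i) E i).
Proof.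
by move=> h; elim/big_ind: _ => //; [apply: divides0 | apply: dividesD].
Qed.

Lemma prime_divides_prod p s :
  prime_elt p -> divides p (\prod_(q <- s) q) -> exists2 q, q \in s & divides p q.
Proof.
move=> [p0 pU pP]; elim: s => [|q s IHs].
  rewrite big_nil => -[c /esym c1]; case/negP: pU; apply/unitrP.
  by exists c; rewrite [p * c]mulrC c1.
rewrite big_cons => /pP [pq|/IHs [r rs pr]].
  by exists q => //; rewrite mem_head.
by exists r => //; rewrite inE rs orbT.
Qed.

Lemma prime_divides_unit p u : prime_elt p -> u \is a GRing.unit -> ~ divides p u.
Proof.
move=> [_ pU _] uU [c uE]; move: uU pU; rewrite uE unitrM.
by case/andP => _ ->.
Qed.

Lemma prime_factor p u s : prime_elt p -> u \is a GRing.unit ->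
  divides p (u * \prod_(q <- s) q) -> exists2 q, q \in s & divides p q.
Proof.
move=> pP uU; case: (pP) => _ _ pM /pM [/(prime_divides_unit pP uU) //|].
exact: prime_divides_prod.
Qed.

Lemma prime_divides_prime p q : prime_elt p -> prime_elt q -> divides p q ->
  exists2 t, t \is a GRing.unit & q = t * p.
Proof.
move=> [p0 pU pM] [q0 qU qM] [t qE]; exists t => //.
have qtp : divides q (t * p) by rewrite -qE; apply: divides_refl.
case: (qM _ _ qtp) => -[k kE].
  case/negP: pU; apply/unitrP; exists k.
  suff kp : k * p = 1 by rewrite [p * k]mulrC kp.
  by apply: (mulIf q0); rewrite mul1r mulrAC -kE -qE.
apply/unitrP; exists k.
suff kt : k * t = 1 by rewrite [t * k]mulrC kt.
by apply: (mulIf p0); rewrite mul1r -mulrA -qE -kE.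
Qed.

(** Each prime [r] in [cs] divides some prime of the given factorization, so the two are associated
    and cancel up to a unit. *)
Lemma factored_cancel (cs : seq S) a : (forall p, p \in cs -> prime_elt p) ->
  factored ((\prod_(p <- cs) p) * a) -> factored a.
Proof.
elim: cs => [_|r cs IHcs csP]; first by rewrite big_nil mul1r.
have rP : prime_elt r by apply: csP; rewrite mem_head.
rewrite big_cons => -[s [u uU [E sP]]].
have : divides r (u * \prod_(p <- s) p).
  by rewrite -E -mulrA; apply: dividesMr; apply: divides_refl.
case/(prime_factor rP uU) => q qs.
case/(prime_divides_prime rP (sP _ qs)) => t tU qE.
apply: IHcs => [p pcs|]; first by apply: csP; rewrite inE pcs orbT.
exists (rem q s); exists (u * t); first by rewrite unitrM uU tU.
split=> [|p /mem_rem]; last exact: sP.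
case: (rP) => r0 _ _; apply: (mulfI r0); rewrite mulrA E.
by rewrite (perm_big _ (perm_to_rem qs)) big_cons /= qE; ring.
Qed.

Lemma factored_mul a b : factored a -> factored b -> factored (a * b).
Proof.
move=> [s [u uU [-> sP]]] [t [v vU [-> tP]]].
exists (s ++ t); exists (u * v); first by rewrite unitrM uU vU.
split=> [|p]; first by rewrite big_cat /=; ring.
by rewrite mem_cat => /orP [/sP|/tP].
Qed.

Lemma factored_prime p : prime_elt p -> factored p.
Proof.
move=> pP; exists [:: p]; exists 1; first exact: unitr1.
by split=> [|q]; rewrite ?big_seq1 ?mul1r // inE => /eqP->.
Qed.

End Divisibility.

(** The factors are required to be prime and not just irreducible, which makes factorizations
    unique; hence only existence is stated. *)
Definition factorial (S : idomainType) : Prop :=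
  forall a : S, a != 0 -> factored a.

Lemma factorial_field (K : fieldType) : factorial K.
Proof.
by move=> a a0; exists [::]; exists a; rewrite ?unitfE // big_nil mulr1.
Qed.

Section GeneratedIdeal.
Variable S : comNzRingType.

Definition is_ideal (J : S -> Prop) : Prop :=
  J 0 /\ forall c a b, J a -> J b -> J (c * a + b).

(** The ideal generated by [fs], as an intersection: a property holds on it as soon as it defines an
    ideal containing [fs]. *)
Definition generated (fs : seq S) (a : S) : Prop :=
  forall J, is_ideal J -> (forall f, f \in fs -> J f) -> J a.

Lemma generated_ideal fs : is_ideal (generated fs).
Proof.
split=> [J [] //|c a b ha hb J JI Jfs].
by case: (JI) => _; apply; [apply: ha|apply: hb].
Qed.

Lemma generated_mem fs f : f \in fs -> generated fs f.
Proof. by move=> ffs J _; apply. Qed.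

End GeneratedIdeal.

(** * Gauss's lemma and unique factorization in S[X] *)

Section Gauss.
Variable S : idomainType.
Implicit Types (f g h : {poly S}).

Lemma divides_polyC (a : S) f : divides a%:P f <-> forall i, divides a f`_i.
Proof.
split=> [[g ->] i|h]; first by exists g`_i; rewrite coefMC.
have [c cE] := choice h.
exists (\poly_(i < size f) c i); apply/polyP => i; rewrite coefMC coef_poly.
by case: ltnP => [_|/leq_sizeP/(_ _ (leqnn _))->]; rewrite -?cE ?mul0r.
Qed.

(** Gauss's lemma: if [i] and [j] are the least indices of coefficients of [f] and [g] not divisible
    by [p], then [p] does not divide the coefficient of [f * g] of index [i + j]. *)
Lemma prime_polyC (p : S) : prime_elt p -> prime_elt p%:P.
Proof.
move=> [p0 pU pM]; split=> [||f g].
- by rewrite polyC_eq0.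
- by rewrite poly_unitE size_polyC p0 /= coefC.
move=> /divides_polyC fgP; apply: contrapT => /not_orP[].
move=> /divides_polyC /existsNP [i0 i0P] /divides_polyC /existsNP [j0 j0P].
have exi : exists i, `[< ~ divides p f`_i >] by exists i0; apply/asboolP.
have exj : exists j, `[< ~ divides p g`_j >] by exists j0; apply/asboolP.
case: (ex_minnP exi) => i /asboolP iP imin.
case: (ex_minnP exj) => j /asboolP jP jmin.
have lti k : (k < i)%N -> divides p f`_k.
  by move=> ki; apply: contrapT => /asboolP /imin; rewrite leqNgt ki.
have ltj k : (k < j)%N -> divides p g`_k.
  by move=> kj; apply: contrapT => /asboolP /jmin; rewrite leqNgt kj.
have iij : (i < (i + j).+1)%N by rewrite ltnS leq_addr.
have := fgP (i + j)%N; rewrite coefM (bigD1 (Ordinal iij)) //= addKn => pd.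
have : divides p (f`_i * g`_j).
  rewrite -[f`_i * _](addrK (\sum_(k < (i + j).+1 | k != Ordinal iij)
    f`_k * g`_(i + j - k))).
  apply: dividesB => //; apply: divides_sum => k; rewrite -val_eqE /= => ki.
  case: (ltngtP k i) ki => // ki _; first exact/dividesMr/lti.
  by apply/dividesMl/ltj; have := ltn_ord k; lia.
by case/pM.
Qed.

(* Pseudo-division by an element of least degree leaves no remainder. *)
Lemma ideal_least (J : {poly S} -> Prop) : is_ideal J ->
  (exists2 f, J f & f != 0) ->
  exists h, [/\ J h, h != 0 &
    forall f, J f -> exists2 c : S, c != 0 & divides h (c *: f)].
Proof.
move=> [J0 JD] [f0 Jf0 f00].
have ex : exists n, `[< exists f, [/\ J f, f != 0 & size f = n] >].
  by exists (size f0); apply/asboolP; exists f0.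
case: (ex_minnP ex) => n /asboolP [h [Jh h0 hn]] hmin.
exists h; split=> // f Jf.
exists (lead_coef h ^+ scalp f h); first by rewrite expf_neq0 ?lead_coef_eq0.
have := Pdiv.WeakIdomain.divp_eq f h => E.
have Jr : J (f %% h)%R.
  have -> : (f %% h = (lead_coef h ^+ scalp f h)%:P * f + ((- (f %/ h)) * h + 0)).
    by rewrite mul_polyC E; ring.
  by apply: (JD) => //; apply: (JD).
have [r0|r0] := eqVneq (f %% h) 0.
  by exists (f %/ h); rewrite E r0 addr0.
have := hmin (size (f %% h)).
have -> : `[< exists f1, [/\ J f1, f1 != 0 & size f1 = size (f %% h)] >].
  by apply/asboolP; exists (f %% h).
move=> /(_ isT); rewrite -hn leqNgt.
by rewrite Pdiv.CommonIdomain.ltn_modpN0.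
Qed.

Hypothesis facS : factorial S.

Lemma factored_polyC (c : S) : c != 0 -> factored c%:P.
Proof.
move=> /facS [s [u uU [-> sP]]].
exists [seq p%:P | p <- s]; exists u%:P; first by rewrite rmorph_unit.
split=> [|p /mapP [q qs ->]]; last by apply/prime_polyC/sP.
by rewrite rmorphM rmorph_prod big_map.
Qed.

Lemma factored_scale_cancel (c : S) f : c != 0 -> factored (c *: f) -> factored f.
Proof.
move=> /facS [s [u uU [-> sP]]].
rewrite -mul_polyC rmorphM -mulrA => -[t [v vU [E tP]]].
apply: (@factored_cancel _ [seq p%:P | p <- s]) => [p /mapP [q qs ->]|].
  exact/prime_polyC/sP.
have uP : u%:P \is a @GRing.unit {poly S} by rewrite rmorph_unit.
exists t; exists (u%:P^-1 * v); first by rewrite unitrM unitrV uP.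
split=> //; apply: (mulrI uP); rewrite big_map -rmorph_prod E.
by rewrite mulrA [u%:P * (_ * _)]mulrA divrr // mul1r.
Qed.

(** The prime factors of [c] are removed one at a time: each divides the product of [g] and its
    cofactor but not [g], hence divides the cofactor. *)
Lemma primitive_divides_scale (c : S) f g :
  (forall p : S, prime_elt p -> ~ divides p%:P g) -> c != 0 ->
  divides g (c *: f) -> divides g f.
Proof.
move=> gprim /facS [s [u uU [-> sP]]] [h E].
elim: s u uU h E sP => [|p s IHs] u uU h E sP.
  exists (u^-1 *: h); rewrite -scalerAl -E big_nil mulr1 scalerA mulVr //.
  by rewrite scale1r.
have pP : prime_elt p by apply: sP; rewrite mem_head.
have /prime_polyC pP' := pP.
have : divides p%:P (h * g).
  rewrite -E big_cons -mul_polyC; apply: dividesMr; rewrite mulrCA rmorphM.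
  exact/dividesMr/divides_refl.
case: (pP') => p0 _ pM /pM [[k hE]|/gprim]; last by [].
apply: (IHs u uU k) => [|q qs]; last by apply: sP; rewrite inE qs orbT.
apply: (mulfI p0); rewrite mulrA [_ * k]mulrC -hE -E big_cons mul_polyC scalerA.
by congr (_ *: _); ring.
Qed.

(** If [f] is not prime, it divides some [g * h] without dividing [g] or [h]. Let [k] have least
    degree in the ideal (f, g), so that [c *: f = q * k] with a constant [c]. A constant [k] or [q]
    contradicts the choice of [g] and [h]; otherwise both have smaller degree than [f]. *)
Lemma factored_primitive_or_prime f :
  (1 < size f)%N -> (forall p : S, prime_elt p -> ~ divides p%:P f) ->
  (forall g : {poly S}, (size g < size f)%N -> g != 0 -> factored g) ->
    factored f.
Proof.
move=> sf fprim IH; have f0 : f != 0 by rewrite -size_poly_gt0 ltnW.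
have [fP|fnP] := pselect (prime_elt f); first exact: factored_prime.
have [g [h [fgh nfg nfh]]] :
    exists g h, [/\ divides f (g * h), ~ divides f g & ~ divides f h].
  apply: contrapT => nE; apply: fnP; split=> // [|g h fgh].
    rewrite poly_unitE; apply/negP => /andP [/eqP s1 _].
    by rewrite s1 in sf.
  by apply: contrapT => /not_orP [nfg nfh]; apply: nE; exists g, h.
have JI := generated_ideal [:: f; g].
have Jf : generated [:: f; g] f by apply: generated_mem; rewrite mem_head.
have Jg : generated [:: f; g] g by apply: generated_mem; rewrite !inE eqxx orbT.
have [k [Jk k0 kmin]] := ideal_least JI (ex_intro2 _ _ f Jf f0).
have [c c0 [q fE]] := kmin f Jf.
have [d d0 [r gE]] := kmin g Jg.
have q0 : q != 0.
  by apply: contraTneq sf => q0; rewrite -(size_scale f c0) fE q0 mul0r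
    size_poly0.
have sE : size f = (size q + size k).-1 by rewrite -(size_scale f c0) fE size_mul.
have sq : (0 < size q)%N by rewrite size_poly_gt0.
have sk : (0 < size k)%N by rewrite size_poly_gt0.
(* If [k] is constant: [f] divides [a * h] for all [a] in the ideal, so it divides [k * h] and,
   being primitive, [h]. *)
have [sk1|sk1] := leqP (size k) 1.
  have kh : divides f (k * h).
    have : is_ideal (fun a => divides f (a * h)).
      split=> [|e a b fa fb]; first by rewrite mul0r; apply: divides0.
      by rewrite mulrDl -mulrA; apply: dividesD => //; apply: dividesMl.
    move/(Jk (fun a => divides f (a * h))); apply.
    by move=> a; rewrite !inE => /orP [] /eqP -> //; apply/dividesMr/divides_refl.
  case: nfh; apply: (@primitive_divides_scale k`_0) => //.
    by rewrite -polyC_eq0 -size1_polyC.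
  by rewrite -mul_polyC -size1_polyC.
(* If [q] is constant: [k] is [f] up to constants, so [f] divides a constant multiple of [g] and,
   being primitive, [g]. *)
have [sq1|sq1] := leqP (size q) 1.
  case: nfg; apply: (@primitive_divides_scale (q`_0 * d)) => //.
    by rewrite mulf_neq0 // -polyC_eq0 -size1_polyC.
  exists (c%:P * r).
  rewrite -scalerA gE scalerAr -mul_polyC -size1_polyC // -fE -mul_polyC.
  by ring.
apply: (factored_scale_cancel c0); rewrite fE.
by apply: factored_mul; apply: IH => //; lia.
Qed.

(** Induction on the degree and, within it, on the number of prime factors of the leading
    coefficient: when [f] is not primitive, dividing out a constant prime lowers this number. *)
Lemma factorial_poly : factorial {poly S}.
Proof.
move=> f; have [n] := ubnP (size f); elim: n f => // n IHn f sf f0.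
have [sf1|sf1] := leqP (size f) 1.
  by rewrite [f]size1_polyC //; apply: factored_polyC;
     rewrite -polyC_eq0 -size1_polyC.
have l0 : lead_coef f != 0 by rewrite lead_coef_eq0.
have [s [u uU [lE sP]]] := facS l0.
have [m] := ubnP (size s); elim: m f sf f0 sf1 s u uU lE sP l0 => // m IHm.
move=> f sf f0 sf1 s u uU lE sP l0 sm.
have [fprim|] := pselect (forall p : S, prime_elt p -> ~ divides p%:P f).
  by apply: factored_primitive_or_prime => // g gf; apply: IHn; lia.
move=> /existsNP [p /not_implyP [pP /contrapT [g fE]]].
have p0 : p != 0 by case: pP.
rewrite fE; apply: factored_mul; last exact/factored_prime/prime_polyC.
have g0 : g != 0 by apply: contraNneq f0 => g0; rewrite fE g0 mul0r.
have gf : size g = size f by rewrite fE mulrC mul_polyC size_scale.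
have : divides p (u * \prod_(q <- s) q).
  by rewrite -lE fE lead_coefM lead_coefC; apply/dividesMl/divides_refl.
case/(prime_factor pP uU) => q qs.
case/(prime_divides_prime pP (sP _ qs)) => t tU qE.
apply: (IHm _ _ _ _ (rem q s) (u * t)).
- by rewrite gf.
- by [].
- by rewrite gf.
- by rewrite unitrM uU tU.
- apply: (mulIf p0); rewrite -[X in _ * X = _](lead_coefC p) -lead_coefM -fE lE.
  by rewrite (perm_big _ (perm_to_rem qs)) big_cons /= qE; ring.
- by move=> x /mem_rem; apply: sP.
- by rewrite lead_coef_eq0.
- by rewrite size_rem //; case: (s) qs sm => //= *; lia.
Qed.

End Gauss.

(** * Iterated polynomial rings *)

(* The outermost variable is the variable number 0. *)
Fixpoint ipoly (A : idomainType) (n : nat) : idomainType :=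
  if n is m.+1 then ({poly ipoly A m} : idomainType) else A.

Lemma factorial_ipoly (A : idomainType) n : factorial A -> factorial (ipoly A n).
Proof. by move=> facA; elim: n => //= n IHn; apply: factorial_poly. Qed.

Lemma poly_rmorph_ext (R S : comNzRingType) (phi chi :
  {rmorphism {poly R} -> S}) :
  (forall c, phi c%:P = chi c%:P) -> phi 'X = chi 'X -> phi =1 chi.
Proof.
move=> hC hX g; rewrite -[g]coefK poly_def !rmorph_sum.
by apply: eq_bigr => i _; rewrite -mul_polyC !rmorphM !rmorphXn /= hC hX.
Qed.

Section Evaluation.
Variables (A : idomainType).

Fixpoint ipolyC n : {rmorphism A -> ipoly A n} :=
  match n return {rmorphism A -> ipoly A n} with
  | 0 => idfun
  | m.+1 => (@polyC (ipoly A m) \o ipolyC m : {rmorphism _ -> _})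
  end.

Fixpoint ipolyX n (k : nat) : ipoly A n :=
  match n return ipoly A n with
  | 0 => 0
  | m.+1 => if k is k'.+1 then (ipolyX m k')%:P else 'X
  end.

Variables (S : comNzRingType) (psi : {rmorphism A -> S}).

(** The head of [xs] goes to the outermost variable; missing values are taken to be 0. *)
Fixpoint ieval n (xs : seq S) : {rmorphism ipoly A n -> S} :=
  match n return {rmorphism ipoly A n -> S} with
  | 0 => psi
  | m.+1 => (horner_eval (head 0 xs) \o map_poly (ieval m (behead xs))
             : {rmorphism {poly ipoly A m} -> S})
  end.

Lemma ieval_cons n x xs (g : {poly ipoly A n}) :
  ieval n.+1 (x :: xs) g = (map_poly (ieval n xs) g).[x].
Proof. by []. Qed.

Lemma ievalC n xs a : ieval n xs (ipolyC n a) = psi a.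
Proof.
elim: n xs => //= n IHn xs.
by rewrite /horner_eval /= map_polyC /= hornerC IHn.
Qed.

Lemma ievalX n xs k : (k < n)%N -> ieval n xs (ipolyX n k) = nth 0 xs k.
Proof.
elim: n xs k => //= n IHn xs [_|k kn]; rewrite /horner_eval /=.
  by rewrite map_polyX hornerX nth0.
by rewrite map_polyC hornerC /= IHn // nth_behead.
Qed.

Lemma ipoly_rmorph_ext n (phi chi : {rmorphism ipoly A n -> S}) :
  (forall a, phi (ipolyC n a) = chi (ipolyC n a)) ->
  (forall k, (k < n)%N -> phi (ipolyX n k) = chi (ipolyX n k)) -> phi =1 chi.
Proof.
elim: n phi chi => [|n IHn] phi chi hC hX; first exact: hC.
apply: poly_rmorph_ext => [c|]; last exact: (hX 0%N).
apply: (IHn (phi \o polyC : {rmorphism _ -> _})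
            (chi \o polyC : {rmorphism _ -> _})) => [a|k kn]; first exact: hC.
exact: (hX k.+1).
Qed.

End Evaluation.

(** * Derivations *)

Definition is_derivation (S : comNzRingType) (D : S -> S) : Prop :=
  {morph D : a b / a + b} /\ (forall a b, D (a * b) = D a * b + a * D b).

Section Derivation.
Variables (S : comNzRingType) (D : S -> S).
Hypothesis DD : is_derivation D.

Lemma derivation0 : D 0 = 0.
Proof.
by case: DD => D1 _; apply: (addrI (D 0)); rewrite -D1 !addr0.
Qed.

Lemma derivation1 : D 1 = 0.
Proof.
by case: DD => _ D2; have := D2 1 1; rewrite !mulr1 mul1r => h; apply:
  (addrI (D 1)); rewrite -h addr0.
Qed.

Lemma derivation_sum (I : Type) (r : seq I) (P : pred I) (E : I -> S) :
  D (\sum_(i <- r | P i) E i) = \sum_(i <- r | P i) D (E i).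
Proof. by apply: big_morph; [case: DD | apply: derivation0]. Qed.

Lemma derivation_pchar (p : nat) a : p \in [pchar S] -> D (a ^+ p) = 0.
Proof.
move=> pS; case: (DD) => D1 D2.
suff h m : D (a ^+ m) = (a ^+ m.-1 * D a) *+ m.
  by rewrite h -mulr_natr pcharf0 // mulr0.
elim: m => [|m IHm]; first by rewrite expr0 derivation1 mulr0n.
rewrite exprS D2 IHm /=; case: m {IHm} => [|m];
  first by rewrite !expr0 mulr0n mulr0 addr0 mulr1 mul1r mulr1n.
by rewrite mulrnAr mulrA -exprS [D a * _]mulrC -mulrS.
Qed.

Lemma coef_map_derivation (g : {poly S}) i : (map_poly D g)`_i = D g`_i.
Proof. by rewrite coef_map_id0 // derivation0. Qed.

Lemma is_derivation_map_poly : is_derivation (map_poly D : {poly S} -> {poly S}).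
Proof.
case: (DD) => D1 D2; split=> [a b|a b]; apply/polyP => i.
  by rewrite coefD !coef_map_derivation coefD D1.
rewrite coefD !coefM coef_map_derivation coefM derivation_sum -big_split /=.
by apply: eq_bigr => j _; rewrite !coef_map_derivation D2.
Qed.

Lemma deriv_map_derivation (g : {poly S}) : (map_poly D g)^`() = map_poly D g^`().
Proof.
apply/polyP => i; rewrite coef_map_derivation !coef_deriv coef_map_derivation.
have h m a : D (a *+ m) = D a *+ m.
  case: (DD) => D1 _.
  by elim: m => [|m IHm]; rewrite ?mulr0n ?derivation0 // !mulrS D1 IHm.
by rewrite h.
Qed.

End Derivation.

Lemma is_derivation_deriv (S : comNzRingType) : is_derivation (@deriv S).
Proof. by split=> [a b|a b]; rewrite ?derivD ?derivM. Qed.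

Lemma is_derivation_zero (S : comNzRingType) : is_derivation (fun _ : S => 0).
Proof. by split=> [a b|a b]; rewrite ?addr0 ?mul0r ?mulr0 ?addr0. Qed.

Section Partial.
Variable A : idomainType.

Fixpoint coefwise (D : A -> A) n : ipoly A n -> ipoly A n :=
  match n return ipoly A n -> ipoly A n with
  | 0 => D
  | m.+1 => map_poly (coefwise D (n := m))
  end.

Fixpoint partial n k : ipoly A n -> ipoly A n :=
  match n return ipoly A n -> ipoly A n with
  | 0 => fun _ => 0
  | m.+1 => if k is k'.+1 then map_poly (partial k' (n := m)) else @deriv _
  end.

Lemma is_derivation_coefwise D n :
  is_derivation D -> is_derivation (@coefwise D n).
Proof. by move=> DD; elim: n => //= n IHn; apply: is_derivation_map_poly. Qed.

Lemma is_derivation_partial n k : is_derivation (@partial n k).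
Proof.
elim: n k => [|n IHn] [|k] //=; [exact: is_derivation_zero|exact:
  is_derivation_zero|exact: is_derivation_deriv|].
exact: is_derivation_map_poly.
Qed.

Lemma partial_coefwise D n k (g : ipoly A n) : is_derivation D ->
  partial k (coefwise D g) = coefwise D (partial k g).
Proof.
move=> DD; elim: n k g => [|n IHn] [|k] g /=; rewrite ?derivation0 //.
  exact/deriv_map_derivation/is_derivation_coefwise.
have DC := is_derivation_coefwise n DD; have DP := is_derivation_partial n k.
apply/polyP => i.
by rewrite coef_map_derivation // coef_map_derivation // coef_map_derivation //
  coef_map_derivation.
Qed.

Lemma map_polyC0 (S : nzRingType) (h : S -> S) c :
  h 0 = 0 -> map_poly h c%:P = (h c)%:P.
Proof.
by move=> h0; apply/polyP => i; rewrite coef_map_id0 // !coefC; case: eqP.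
Qed.

Lemma coefwiseC D n a : is_derivation D ->
  coefwise D (ipolyC A n a) = ipolyC A n (D a).
Proof.
move=> DD; elim: n => //= n IHn.
by rewrite map_polyC0 ?IHn // (derivation0 (is_derivation_coefwise n DD)).
Qed.

Lemma coefwiseX D n k : is_derivation D -> coefwise D (ipolyX A n k) = 0.
Proof.
move=> DD; elim: n k => [|n IHn] k /=; first exact: derivation0.
have DC := is_derivation_coefwise n DD; case: k => [|k].
  apply/polyP => i; rewrite coef_map_derivation // coefX coef0.
  by case: eqP => _; rewrite ?(derivation1 DC) ?(derivation0 DC).
by rewrite map_polyC0 ?IHn ?(derivation0 DC).
Qed.

Lemma partialC n k a : partial k (ipolyC A n a) = 0.
Proof.
elim: n k => //= n IHn [|k]; first by rewrite derivC.
by rewrite map_polyC0 ?IHn // (derivation0 (is_derivation_partial n k)).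
Qed.

Lemma partialX n k l : (k < n)%N -> partial k (ipolyX A n l) = (k == l)%:R.
Proof.
elim: n k l => //= n IHn [|k] [|l] kn; rewrite ?derivX ?derivC //.
  have DC := is_derivation_partial n k.
  apply/polyP => i; rewrite coef_map_derivation // coefX coef0.
  by case: eqP => _; rewrite ?(derivation1 DC) ?(derivation0 DC).
by rewrite map_polyC0 ?IHn ?(derivation0 (is_derivation_partial n k)) // polyCMn.
Qed.

Lemma pchar_ipoly n : [pchar ipoly A n] =i [pchar A].
Proof. by elim: n => // n IHn p /=; rewrite pchar_poly IHn. Qed.

Lemma poly_exp_pchar (S : comNzRingType) (p : nat) m (c : nat -> S) :
  p \in [pchar S] ->
  (\poly_(i < m) c i) ^+ p = \sum_(i < m) c i ^+ p *: 'X^(i * p).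
Proof.
move=> pS; have pP : p \in [pchar {poly S}] by rewrite pchar_poly.
rewrite poly_def -(pFrobenius_autE pP) rmorph_sum; apply: eq_bigr => i _.
by rewrite /= pFrobenius_autE exprZn -exprM.
Qed.

(** A vanishing derivative leaves only exponents divisible by [p], and the roots of the coefficients
    assemble because the power [p] is additive. *)
Lemma poly_pth_power (S : idomainType) (p : nat) (g : {poly S}) :
  p \in [pchar S] -> g^`() = 0 -> (forall i, exists c, g`_i = c ^+ p) ->
  exists h, g = h ^+ p.
Proof.
move=> pS g'0 /choice [c cE].
have p0 : (0 < p)%N by rewrite prime_gt0 // (pcharf_prime pS).
have g0 j : ~~ (p %| j)%N -> g`_j = 0.
  case: j => [|j pj]; first by rewrite dvdn0.
  have /polyP/(_ j) := g'0; rewrite coef_deriv coef0 -mulr_natr => /eqP.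
  by rewrite mulf_eq0 -(dvdn_pcharf pS) (negPf pj) orbF => /eqP.
exists (\poly_(i < size g) c (i * p)%N); rewrite poly_exp_pchar //.
apply/polyP => j; rewrite coef_sum.
have E (i : 'I_(size g)) : (c (i * p)%N ^+ p *: 'X^(i * p))`_j
    = g`_j *+ (i * p == j)%N.
  rewrite coefZ coefXn -cE eq_sym.
  by case: eqP => [->|_]; rewrite ?mulr1 ?mulr0 ?mulr1n ?mulr0n.
under eq_bigr do rewrite E.
have [pj|/g0->] := boolP (p %| j)%N; last by rewrite big1 // => i _;
  rewrite mul0rn.
have [sj|sj] := ltnP j (size g); last first.
  by rewrite nth_default // big1 // => i _; rewrite mul0rn.
have jp : (j %/ p < size g)%N by apply: leq_ltn_trans sj; apply: leq_div.
rewrite (bigD1 (Ordinal jp)) //= divnK // eqxx mulr1n big1 ?addr0 // => i.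
rewrite -val_eqE /= => ij; case: eqP => [E'|_ //].
by rewrite -E' mulnK ?eqxx in ij.
Qed.

(** The derivative in the outermost variable is handled by [poly_pth_power]; the other hypotheses
    pass to the coefficients, down to the constants, where [Dp] applies. *)
Lemma ipoly_pth_power (p : nat) (D : A -> A) : p \in [pchar A] ->
  (forall a, D a = 0 -> exists c, a = c ^+ p) ->
  is_derivation D ->
  forall n (g : ipoly A n), coefwise D g = 0 ->
  (forall k, (k < n)%N -> partial k g = 0) -> exists h, g = h ^+ p.
Proof.
move=> pA Dp DD; elim=> [|n IHn] g Dg0 hg; first exact: Dp.
apply: poly_pth_power; [by rewrite pchar_ipoly|exact: (hg 0%N)|move=> i].
apply: IHn => [|k kn].
  have /polyP/(_ i) := Dg0; rewrite coef0 coef_map_derivation //.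
  exact: is_derivation_coefwise.
have /polyP/(_ i) := hg k.+1 kn; rewrite coef0 coef_map_derivation //.
exact: is_derivation_partial.
Qed.

End Partial.

(** In F[t] a nonzero polynomial has larger degree than its derivative. With more variables, the
    induction runs through the coefficients. *)
Lemma divides_deriv (F : fieldType) n (g : ipoly {poly F} n) :
  divides g (coefwise (@deriv F) g) -> coefwise (@deriv F) g = 0.
Proof.
have DD := is_derivation_deriv F; elim: n g => [|n IHn] g /= [h hE].
  have [->|g0] := eqVneq (g : {poly F}) 0; first exact: deriv0.
  apply/eqP; apply: contraLR (lt_size_deriv g0) => g'0.
  rewrite -leqNgt hE size_mul //; last by apply: contraNneq g'0; rewrite hE =>
    ->; rewrite mul0r.
  have : (0 < size (h : {poly F}))%N.
    by rewrite size_poly_gt0; apply: contraNneq g'0; rewrite hE => ->;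
      rewrite mul0r.
  by case: (size (h : {poly F})) => // k _; rewrite addSn leq_addl.
have DC := is_derivation_coefwise n DD.
pose g1 : {poly ipoly {poly F} n} := g; pose h1 : {poly ipoly {poly F} n} := h.
have {}hE : map_poly (coefwise (@deriv F) (n := n)) g1 = h1 * g1 by [].
change (map_poly (coefwise (@deriv F) (n := n)) g1 = 0).
have [g0|g0] := eqVneq g1 0; first by rewrite hE g0 mulr0.
have [h0|h0] := eqVneq h1 0; first by rewrite hE h0 mul0r.
(* The derivative in t does not raise the degree in the outermost variable, so the cofactor is free
   of it and the divisibility holds coefficient by coefficient. *)
have sh : size h1 = 1%N.
  have : (size (map_poly (coefwise (@deriv F) (n := n)) g1) <= size g1)%N.
    exact: size_poly.
  rewrite hE size_mul //.
  have : (0 < size h1)%N by rewrite size_poly_gt0.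
  have : (0 < size g1)%N by rewrite size_poly_gt0.
  by move: (size g1) (size h1) => a b; lia.
have hC : h1 = (h1`_0)%:P by rewrite -size1_polyC // sh.
have gi i : coefwise (@deriv F) g1`_i = h1`_0 * g1`_i.
  by rewrite -coef_map_derivation // hE hC coefCM -hC.
apply/polyP => i; rewrite coef_map_derivation // coef0.
by apply: IHn; exists h1`_0; apply: gi.
Qed.

(** The chain rule has no other terms, since the substituted values have derivative 0, as p-th
    powers do. *)
Lemma deriv_ieval (F : fieldType) n (xs : seq {poly F}) (g : ipoly {poly F} n) :
  (forall x, x \in xs -> x^`() = 0) ->
  (ieval idfun n xs g)^`() = ieval idfun n xs (coefwise (@deriv F) g).
Proof.
have DD := is_derivation_deriv F.
elim: n xs g => [|n IHn] xs g xs0 //=.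
have DC := is_derivation_coefwise n DD.
have hx : (head 0 xs)^`() = 0.
  by case: xs xs0 => [|x xs] xs0 /=; rewrite ?deriv0 // xs0 // mem_head.
have hb x : x \in behead xs -> x^`() = 0 by move=> /mem_behead/xs0.
have [C1 C2] := is_derivation_map_poly DC.
rewrite /horner_eval.
elim/poly_ind: (g : {poly _}) => [|q c IHq].
  by rewrite (derivation0 (is_derivation_map_poly DC)) !rmorph0 !horner0 deriv0.
have X0 : map_poly (coefwise (@deriv F) (n := n)) 'X = 0 := coefwiseX n.+1 0 DD.
rewrite C1 C2 X0 mulr0 addr0.
rewrite map_polyC0 ?(derivation0 DC) // !rmorphD !rmorphM /= !map_polyC
  !map_polyX.
rewrite !hornerD !hornerM !hornerX !hornerC derivD derivM hx mulr0 addr0 IHq.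
by rewrite IHn.
Qed.

(** * The jet substitution *)

Lemma mpoly_rmorph_ext (n : nat) (R S : comNzRingType)
    (phi chi : {rmorphism mpoly n R -> S}) :
  (forall c, phi (mpolyC n c) = chi (mpolyC n c)) ->
  (forall i, phi (mpolyX R (mnm1 i)) = chi (mpolyX R (mnm1 i))) -> phi =1 chi.
Proof.
move=> hC hX g; rewrite [g]mpolyE !rmorph_sum; apply: eq_bigr => m _.
rewrite -mul_mpolyC mpolyXE_id !rmorphM hC !rmorph_prod; congr (_ * _).
by apply: eq_bigr => i _; rewrite !rmorphXn /= hX.
Qed.

Section JetSubstitution.
Variables (F : fieldType) (p : nat) (n : nat).
Hypothesis pF : p \in [pchar F].
Let A := {poly F} : idomainType.
Let p_pr : prime p := pcharf_prime pF.
Let j0 : 'I_p := Ordinal (prime_gt0 p_pr).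
Let j1 : 'I_p := Ordinal (prime_gt1 p_pr).

Variable s : seq ('I_n * 'I_p).
Hypothesis s_all : forall ij, ij \in s.
Hypothesis s_uniq : uniq s.
Let N := size s.

(** The variable z_ij. Its rank is the position of [ij] in [s], so that [s] fixes the order of the
    variables; it is chosen later according to the box. *)
Definition jvar (ij : 'I_n * 'I_p) : ipoly A N := ipolyX A N (index ij s).

Definition jterm (ij : 'I_n * 'I_p) : ipoly A N := ipolyC A N 'X^(ij.2) * jvar ij.

(** The passage from f to H(z) = f(\sum_j t^j z_ij). *)
Definition jsubst : {rmorphism mpoly n A -> ipoly A N} :=
  mmap (ipolyC A N) (fun i => \sum_(j < p) jterm (i, j)).

Lemma jsubstC c : jsubst (mpolyC n c) = ipolyC A N c.
Proof. by rewrite /jsubst /= mmapC. Qed.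

Lemma jsubstX i : jsubst (mpolyX A (mnm1 i)) = \sum_(j < p) jterm (i, j).
Proof. by rewrite /jsubst /= mmapX mmap1U. Qed.

Lemma jvar_lt ij : (index ij s < N)%N.
Proof. by rewrite index_mem. Qed.

Lemma ieval_jvar (S : comNzRingType) (psi : {rmorphism A -> S})
    (v : 'I_n * 'I_p -> S) ij :
  ieval psi N [seq v k | k <- s] (jvar ij) = v ij.
Proof. by rewrite ievalX ?jvar_lt // (nth_map ij) ?jvar_lt // nth_index. Qed.

Lemma jvar_ext (S : comNzRingType) (phi chi : {rmorphism ipoly A N -> S}) :
  (forall c, phi (ipolyC A N c) = chi (ipolyC A N c)) ->
  (forall ij, phi (jvar ij) = chi (jvar ij)) -> phi =1 chi.
Proof.
move=> hC hX; apply: ipoly_rmorph_ext => // k kN.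
have := hX (nth (tnth (in_tuple s) (Ordinal kN)) s k).
by rewrite /jvar index_uniq.
Qed.

(** A left inverse of [jsubst], which is therefore injective. *)
Definition jretract : {rmorphism ipoly A N -> mpoly n A} :=
  ieval (@mpolyC n A) N
    [seq if ij.2 == j0 then mpolyX A (mnm1 ij.1) else 0 | ij <- s].

Lemma jretractC c : jretract (ipolyC A N c) = mpolyC n c.
Proof. exact: ievalC. Qed.

Lemma jretract_jvar ij :
  jretract (jvar ij) = if ij.2 == j0 then mpolyX A (mnm1 ij.1) else 0.
Proof. by rewrite /jretract ieval_jvar. Qed.

Lemma jsubstK f : jretract (jsubst f) = f.
Proof.
apply: (@mpoly_rmorph_ext n A _ (jretract \o jsubst : {rmorphism _ -> _}) idfun)
  => [c|i] /=; first by rewrite jsubstC jretractC.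
rewrite jsubstX rmorph_sum (bigD1 j0) //= rmorphM jretractC jretract_jvar /=.
rewrite expr0 rmorph1 mul1r big1 ?addr0 // => j jj.
by rewrite rmorphM jretract_jvar /= (negPf jj) mulr0.
Qed.

(* A straight-line homotopy, with parameter ['X], from [jsubst \o jretract] to
   the identity, along which [jsubst f] stays constant. *)
Definition jhomotopy : {rmorphism ipoly A N -> {poly ipoly A N}} :=
  ieval (polyC \o ipolyC A N : {rmorphism _ -> _}) N
    [seq if ij.2 == j0 then
           (jvar ij)%:P + (1 - 'X) * (\sum_(j < p | j != j0) jterm (ij.1, j))%:P
         else 'X * (jvar ij)%:P | ij <- s].

Lemma jhomotopyC c : jhomotopy (ipolyC A N c) = (ipolyC A N c)%:P.
Proof. exact: ievalC. Qed.

Lemma jhomotopy_jvar ij : jhomotopy (jvar ij) = if ij.2 == j0 then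
    (jvar ij)%:P + (1 - 'X) * (\sum_(j < p | j != j0) jterm (ij.1, j))%:P
  else 'X * (jvar ij)%:P.
Proof. by rewrite /jhomotopy ieval_jvar. Qed.

(** What the terms with [j != j0] lose through the factor ['X] is given back by the multiple of
    [1 - 'X] added to z_i0. *)
Lemma jhomotopy_jsubst f : jhomotopy (jsubst f) = (jsubst f)%:P.
Proof.
apply: (@mpoly_rmorph_ext n A _ (jhomotopy \o jsubst : {rmorphism _ -> _})
  (polyC \o jsubst : {rmorphism _ -> _})) => [c|i] /=.
  by rewrite jsubstC jhomotopyC.
rewrite jsubstX rmorph_sum (bigD1 j0) //= [in RHS](bigD1 j0) //= rmorphM.
rewrite jhomotopyC jhomotopy_jvar /= [X in _ = polyC (X
  + _)]/jterm expr0 rmorph1 !mul1r.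
rewrite rmorphD -addrA; congr (_ + _).
rewrite (eq_bigr (fun j => 'X * (jterm (i, j))%:P)) => [|j jj]; last first.
  by rewrite rmorphM jhomotopyC jhomotopy_jvar /= (negPf jj) rmorphM /= mulrCA.
by rewrite -mulr_sumr -rmorph_sum; ring.
Qed.

Lemma jhomotopy1 g : (jhomotopy g).[1] = g.
Proof.
apply: (@jvar_ext _ (horner_eval 1 \o jhomotopy : {rmorphism _ -> _}) idfun)
  => [c|ij] /=; rewrite /horner_eval; first by rewrite jhomotopyC hornerC.
rewrite jhomotopy_jvar; case: ifP => _; rewrite ?hornerE //.
by rewrite subrr mul0r addr0.
Qed.

Lemma jhomotopy0 g : (jhomotopy g).[0] = jsubst (jretract g).
Proof.
apply: (@jvar_ext _ (horner_eval 0 \o jhomotopy : {rmorphism _ -> _})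
  (jsubst \o jretract : {rmorphism _ -> _})) => [c|ij] /=; rewrite /horner_eval.
  by rewrite jhomotopyC hornerC jretractC jsubstC.
rewrite jhomotopy_jvar jretract_jvar; case: ifP => ij0;
  rewrite ?hornerE ?rmorph0 //.
rewrite jsubstX [in RHS](bigD1 j0) //= subr0 mul1r; congr (_ + _).
by case: ij ij0 => i j /= /eqP ->; rewrite /jterm expr0 rmorph1 mul1r.
Qed.

(** Divisors of an element of the image of [jsubst] lie in the image: the homotopy turns [g] into a
    divisor of a nonzero constant in ['X], which is constant in ['X] too, so its values at 1 and at
    0 agree. *)
Lemma divides_jsubst f g : f != 0 -> divides g (jsubst f) ->
  g = jsubst (jretract g).
Proof.
move=> f0 [u E]; have : jhomotopy g * jhomotopy u = (jsubst f)%:P.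
  by rewrite -jhomotopy_jsubst E rmorphM mulrC.
have sf0 : jsubst f != 0.
  by apply: contraNneq f0 => sf0; rewrite -(jsubstK f) sf0 rmorph0.
move=> E'; have /eqP : size (jhomotopy g * jhomotopy u) = 1%N.
  by rewrite E' size_polyC sf0.
rewrite size_mul_eq1 => /andP [/eqP sg _].
by rewrite -jhomotopy0 -[LHS]jhomotopy1 [jhomotopy g]size1_polyC ?sg // !hornerC.
Qed.

(** The difference [E] of the two sides is a derivation in the polynomial. It kills the constants
    and the image of each variable of f, hence the whole image of [jsubst]. *)
Lemma partial_jsubst i j f :
  partial (index (i, j) s) (jsubst f)
  = ipolyC A N 'X^j * partial (index (i, j0) s) (jsubst f).
Proof.
pose E g := partial (index (i, j) s) g
  - ipolyC A N 'X^j * partial (index (i, j0) s) g.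
apply/eqP; rewrite -subr_eq0; apply/eqP; rewrite -/(E (jsubst f)).
have [D1 D2] := is_derivation_partial A N (index (i, j) s).
have [D1' D2'] := is_derivation_partial A N (index (i, j0) s).
have ED : is_derivation E.
  by split=> a b; rewrite /E ?D1 ?D1' ?D2 ?D2'; ring.
have EC c : E (ipolyC A N c) = 0 by rewrite /E !partialC mulr0 subrr.
have EX k : E (jvar k) = ((i, j) == k)%:R - ipolyC A N 'X^j * ((i, j0) == k)%:R.
  rewrite /E !partialX ?jvar_lt //.
  have h a b : (index a s == index b s) = (a == b).
    apply/eqP/eqP => [ab|-> //].
    by rewrite -(nth_index a (s_all a)) ab nth_index.
  by rewrite !h.
have Es m : E (jsubst (mpolyX A (mnm1 m))) = 0.
  rewrite jsubstX (derivation_sum ED).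
  have Et k : E (jterm (m, k)) = ipolyC A N 'X^k * E (jvar (m, k)).
    by case: (ED) => _ ->; rewrite EC mul0r add0r.
  rewrite (eq_bigr (fun k : 'I_p => ipolyC A N 'X^k * (((i, j) == (m, k))%:R
     - ipolyC A N 'X^j * ((i, j0) == (m, k))%:R))) => [|k _];
       last by rewrite Et EX.
  have [<-|im] := eqVneq i m; last first.
    by rewrite big1 // => k _; rewrite !xpair_eqE (negPf im) /= mulr0 subrr mulr0.
  under eq_bigr do rewrite !xpair_eqE eqxx /= mulrBr.
  rewrite sumrB (bigD1 j) //= (eqxx j) mulr1 big1 => [|k kj]; last first.
    by rewrite eq_sym (negPf kj) mulr0.
  rewrite (bigD1 j0) //= mulr1 big1 => [|k kj]; last first.
    by rewrite [j0 == k]eq_sym (negPf kj) !mulr0.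
  by rewrite expr0 rmorph1 mul1r !addr0 subrr.
rewrite [f]mpolyE rmorph_sum (derivation_sum ED) big1 // => m _.
case: (ED) => _ EM.
have EX0 : E (jsubst (mpolyX A m)) = 0.
  rewrite mpolyXE_id rmorph_prod.
  elim/big_ind: _ => [||k _]; first exact: (derivation1 ED).
    by move=> a b a0 b0; rewrite EM a0 b0 mul0r mulr0 addr0.
  rewrite rmorphXn; elim: (m k) => [|e IHe];
    first by rewrite expr0 (derivation1 ED).
  by rewrite exprS EM IHe Es mul0r mulr0 addr0.
by rewrite -mul_mpolyC rmorphM EM EX0 jsubstC EC mul0r mulr0 addr0.
Qed.

Hypothesis rootF : forall c : F, exists d, c = d ^+ p.

Lemma jsubst_coprime (f : mpoly n A) :
  f != 0 ->
  (forall g h : mpoly n A, f = g ^+ 2 * h -> exists c, g = mpolyC n c) ->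
  forall g, prime_elt g -> divides g (jsubst f) ->
    divides g (coefwise (@deriv F) (jsubst f)) -> exists c, g = ipolyC A N c.
Proof.
move=> f0 sqf g gP gf gDf.
have DD := is_derivation_deriv F; have DC := is_derivation_coefwise N DD.
have gE := divides_jsubst f0 gf.
have [u fE] := gf.
have [g0 gU gM] := gP.
(* This is the product rule applied to [jsubst f = u * g]. *)
have : divides g (u * coefwise (@deriv F) g).
  have [_ D2] := DC; move: gDf; rewrite fE D2 => h.
  rewrite -[u * _](addKr (coefwise (@deriv F) u * g)) addrC.
  by apply: dividesB => //; apply/dividesMl/divides_refl.
case/gM => [[v uE]|].
  (* If [g] divides [u], then [g ^+ 2] divides [jsubst f], and the retraction carries this over to a
     square factor of [f]. *)
  have [c rgE] : exists c, jretract g = mpolyC n c.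
    apply: (sqf _ (jretract v)).
    by rewrite -[LHS]jsubstK fE uE !rmorphM /=; ring.
  by exists c; rewrite gE rgE jsubstC.
move/divides_deriv => Dg0.
have par i j : partial (index (i, j) s) g
    = ipolyC A N 'X^j * partial (index (i, j0) s) g.
  by rewrite gE; apply: partial_jsubst.
have par0 i : partial (index (i, j0) s) g = 0.
  have Dp0 k : coefwise (@deriv F) (partial k g) = 0.
    by rewrite -partial_coefwise // Dg0 (derivation0 (is_derivation_partial _ _
      _)).
  (* Applying D = d/dt to d_i1 g = t d_i0 g leaves d_i0 g = 0, because D commutes with the partial
     derivatives and D g = 0. *)
  have := Dp0 (index (i, j1) s); rewrite par; case: (DC) => _ ->.
  by rewrite Dp0 mulr0 addr0 coefwiseC // expr1 derivX rmorph1 mul1r.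
have [h hE] : exists h, g = h ^+ p.
  apply: (@ipoly_pth_power A p (@deriv F)) => //.
  - by rewrite pchar_poly.
  - move=> a a0; apply: poly_pth_power => // i; exact: rootF.
  move=> k kN; have := par0 (nth (tnth (in_tuple s) (Ordinal kN)) s k).1.
  set ij := nth _ _ _ => pij; have := par ij.1 ij.2.
  by rewrite -surjective_pairing pij mulr0 /ij index_uniq.
(* The prime [g = h ^+ p] divides [h], so [h] is a unit and [g] as well, a contradiction. *)
case: gP => _; case/negP.
have gh : divides g h.
  have : divides g (h ^+ p) by rewrite -hE; apply: divides_refl.
  elim: p => [[c /esym c1]|m IHm].
    by case/negP: gU; apply/unitrP; exists c; rewrite [g * c]mulrC c1 expr0.
  by rewrite exprS => /gM [].
have h0 : h != 0.
  by apply: contraNneq g0 => h0; rewrite hE h0 expr0n gtn_eqF ?prime_gt0.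
have [c hc] := gh; rewrite hE; apply: unitrX.
apply/unitrP; exists (c * h ^+ p.-2).
suff E1 : (c * h ^+ p.-2) * h = 1 by rewrite [h * _]mulrC.
have pE : p = p.-2.+2 by case: p p_pr => [|[]].
by apply: (mulIf h0); rewrite mul1r [RHS]hc hE [in RHS]pE 2!exprSr !mulrA.
Qed.

End JetSubstitution.

(** * Averages over boxes of polynomials *)

(** The bound on the number of roots, modulo the prime [pi]: each root [r] is split off by exact
    division of [G - G.[r]%:P], where [pi] divides [G.[r]], and the incongruent roots that remain
    are roots of the quotient. *)
Lemma divides_coef_of_roots (S : idomainType) (pi : S) (rs : seq S)
    (G : {poly S}) :
  prime_elt pi -> uniq rs ->
  (forall x y, x \in rs -> y \in rs -> divides pi (x - y) -> x = y) ->
  (forall x, x \in rs -> divides pi G.[x]) -> (size G <= size rs)%N ->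
  forall i, divides pi G`_i.
Proof.
move=> piP; elim: rs G => [|r rs IHrs] G /=.
  by move=> _ _ _; rewrite leqn0 size_poly_eq0 => /eqP -> i; rewrite coef0;
    apply: divides0.
move=> /andP [rrs urs] dis rootG sG; apply/divides_polyC.
have piGr : divides pi G.[r] by apply: rootG; rewrite mem_head.
have : root (G - G.[r]%:P) r by rewrite rootE !hornerE subrr.
case/factor_theorem => H HE.
have GE : G = H * ('X - r%:P) + G.[r]%:P by rewrite -HE subrK.
rewrite GE; apply: dividesD.
  apply/dividesMr/divides_polyC; apply: IHrs => //.
  - by move=> x y xs ys; apply: dis; rewrite inE ?xs ?ys orbT.
  - move=> x xs; have : divides pi (H.[x] * (x - r)).
      have -> : H.[x] * (x - r) = G.[x] - G.[r] by rewrite {1}GE !hornerE addrK.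
      by apply: dividesB => //; apply: rootG; rewrite inE xs orbT.
    case: (piP) => _ _ pM /pM [//|] /dis xr.
    by rewrite -xr ?mem_head ?inE ?xs ?orbT // in rrs; rewrite xs in rrs.
  have [->|H0] := eqVneq H 0; first by rewrite size_poly0.
  have : (size (H * ('X - r%:P))%R <= (size rs).+1)%N.
    rewrite -HE (leq_trans (size_polyD _ _)) // size_polyN geq_max sG.
    by rewrite (leq_trans (size_polyC_leq1 _)).
  by rewrite size_Mmonic ?monicXsubC // size_XsubC addn2.
by case: piGr => c ->; exists c%:P; rewrite rmorphM.
Qed.

Section Averages.
Variables (R : realType) (F : finFieldType).
Local Notation A := {poly F}.
Implicit Types (d k m : nat) (x y : A).

Definition polys d : seq A := [seq rVpoly u | u <- enum {: 'rV[F]_d}].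

Lemma mem_polys d x : (x \in polys d) = (size x <= d)%N.
Proof.
apply/mapP/idP => [[u _ ->]|sx]; first exact: size_poly.
by exists (poly_rV x); rewrite ?mem_enum // poly_rV_K.
Qed.

Lemma polys_uniq d : uniq (polys d).
Proof. by rewrite map_inj_uniq ?enum_uniq //; apply: can_inj rVpolyK. Qed.

Lemma size_polys d : size (polys d) = (#|F| ^ d)%N.
Proof. by rewrite size_map -cardE card_mx mul1n. Qed.

(** Division with remainder by [N], of degree [a]. *)
Lemma polysD a b (N : A) : size N = a.+1 ->
  perm_eq (polys (a + b)) [seq N * y + r | r <- polys a, y <- polys b].
Proof.
move=> sN; have N0 : N != 0 by rewrite -size_poly_gt0 sN.
apply: uniq_perm; first exact: polys_uniq.
  apply: allpairs_uniq; try exact: polys_uniq.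
  move=> [r y] [r' y'] /allpairsP [[a1 b1] /= [ra yb [-> ->]]].
  move=> /allpairsP [[a2 b2] /= [ra' yb' [-> ->]]] /= E.
  rewrite !mem_polys in ra ra'.
  have {}ra : (size a1 < size N)%N by rewrite sN ltnS.
  have {}ra' : (size a2 < size N)%N by rewrite sN ltnS.
  have E1 : a1 = a2.
    rewrite -(modp_small ra) -(modp_small ra') -(modp_addl_mul_small b1 ra) //.
    by rewrite mulrC E mulrC modp_addl_mul_small // modp_small.
  have E2 : b1 = b2 by move: E; rewrite E1 => /addIr /(mulfI N0).
  by rewrite E1 E2.
move=> x; rewrite mem_polys; apply/idP/allpairsP => [sx|[[r y] /= [ra yb ->]]].
  exists (x %% N, x %/ N); rewrite /= !mem_polys -ltnS -sN ltn_modp N0.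
  split=> //; last by rewrite mulrC -divp_eq.
  by rewrite size_divp // sN leq_subLR.
rewrite !mem_polys in ra yb; rewrite (leq_trans (size_polyD _ _)) // geq_max.
rewrite (leq_trans ra) ?leq_addr // andbT.
have [->|y0] := eqVneq y 0; first by rewrite mulr0 size_poly0.
by rewrite size_mul // sN; move: (size y) yb => s; lia.
Qed.

Local Notation q := (#|F|%:R : R).

Definition av d (h : A -> R) : R := (\sum_(x <- polys d) h x) / q ^+ d.

(** The head of the point, which is the value of the outermost variable, is averaged first with the
    other coordinates fixed; the inductions on the number of variables rely on this order. *)
Fixpoint Ex (ds : seq nat) (h : seq A -> R) : R :=
  if ds is d :: ds' then Ex ds' (fun v => av d (fun x => h (x :: v))) else h [::].

Definition inbox (ds : seq nat) (v : seq A) : bool :=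
  all2 (fun d x => (size x <= d)%N) ds v.

Lemma q_ge2 : 2 <= q.
Proof. by rewrite ler_nat; apply: card_finRing_gt1. Qed.

Lemma q_gt0 : 0 < q.
Proof. by apply: lt_le_trans q_ge2. Qed.

Lemma q_neq0 : q != 0.
Proof. by rewrite gt_eqF ?q_gt0. Qed.

Lemma av_le d h h' : (forall x, (size x <= d)%N -> h x <= h' x) -> av d h <= av
  d h'.
Proof.
move=> hh; rewrite /av ler_pM2r ?invr_gt0 ?exprn_gt0 ?q_gt0 //.
by rewrite !big_seq; apply: ler_sum => x; rewrite mem_polys => /hh.
Qed.

Lemma av_const d c : av d (fun _ => c) = c.
Proof.
rewrite /av big_const_seq count_predT iter_addr_0 size_polys -[c *+ _]mulr_natr.
by rewrite natrX mulfK // expf_neq0 ?q_neq0.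
Qed.

Lemma avD d h h' : av d (fun x => h x + h' x) = av d h + av d h'.
Proof. by rewrite /av big_split mulrDl. Qed.

Lemma avZ d c h : av d (fun x => c * h x) = c * av d h.
Proof. by rewrite /av -mulr_sumr mulrA. Qed.

Lemma av_sum d (I : Type) (r : seq I) (P : pred I) (h : I -> A -> R) :
  av d (fun x => \sum_(i <- r | P i) h i x) = \sum_(i <- r | P i) av d (h i).
Proof. by rewrite /av exchange_big -mulr_suml. Qed.

Lemma eq_av d h h' : (forall x, (size x <= d)%N -> h x = h' x) -> av d h = av d
  h'.
Proof. by move=> hh; apply/le_anti/andP; split; apply: av_le => x /hh ->. Qed.

Lemma sum_polysD a b (N : A) (h : A -> R) : size N = a.+1 ->
  \sum_(x <- polys (a + b)) h x
  = \sum_(r <- polys a) \sum_(y <- polys b) h (N * y + r).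
Proof. by move=> sN; rewrite (perm_big _ (polysD b sN)) /= big_allpairs_dep. Qed.

(** Every residue class modulo [N] occurs equally often among the polynomials of degree less than
    [d], as [d] is at least the degree of [N]. *)
Lemma av_periodic a d (N : A) (h : A -> R) : size N = a.+1 -> (a <= d)%N ->
  (forall x y, h (N * y + x) = h x) -> av d h = av a h.
Proof.
move=> sN ad hN; rewrite /av -(subnKC ad) (sum_polysD _ _ sN).
under eq_bigr => r _ do under eq_bigr => y _ do rewrite hN.
under eq_bigr do rewrite big_const_seq count_predT iter_addr_0 size_polys
  -mulr_natr.
by rewrite -mulr_suml exprD natrX -mulf_div divff ?mulr1 // expf_neq0 ?q_neq0.
Qed.

Lemma Ex_le ds h h' : (forall v, inbox ds v -> h v <= h' v) -> Ex ds h <= Ex ds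
  h'.
Proof.
elim: ds h h' => [|d ds IHds] h h' hh /=; first exact: hh.
by apply: IHds => v vb; apply: av_le => x xd; apply: hh; rewrite /= xd.
Qed.

Lemma eq_Ex ds h h' : (forall v, inbox ds v -> h v = h' v) -> Ex ds h = Ex ds h'.
Proof. by move=> hh; apply/le_anti/andP; split; apply: Ex_le => x /hh ->. Qed.

Lemma Ex_const ds c : Ex ds (fun _ => c) = c.
Proof.
elim: ds => //= d ds IHds; rewrite -[RHS]IHds; apply: eq_Ex => v _.
exact: av_const.
Qed.

Lemma ExD ds h h' : Ex ds (fun v => h v + h' v) = Ex ds h + Ex ds h'.
Proof.
elim: ds h h' => //= d ds IHds h h'; rewrite -IHds; apply: eq_Ex => v _.
exact: avD.
Qed.

Lemma ExZ ds c h : Ex ds (fun v => c * h v) = c * Ex ds h.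
Proof.
elim: ds h => //= d ds IHds h; rewrite -IHds; apply: eq_Ex => v _.
exact: avZ.
Qed.

Lemma inboxP ds (v : seq A) : reflect (size v = size ds /\
   forall i, (i < size ds)%N -> (size (nth 0%R v i) <= nth 0 ds i)%N) (inbox ds
     v).
Proof.
elim: ds v => [|d ds IHds] [|x v]; try by constructor => -[].
  by constructor.
apply: (iffP andP) => /= [[xd /IHds [-> h]]|[[sv] h]].
  by split=> // -[|i] //; apply: h.
by split; [apply: (h 0%N)|apply/IHds; split=> // i; apply: (h i.+1)].
Qed.

Fixpoint boxlist (ds : seq nat) : seq (seq A) :=
  if ds is d :: ds' then [seq x :: v | x <- polys d, v <- boxlist ds'] else [::
    [::]].

Lemma mem_boxlist ds v : (v \in boxlist ds) = inbox ds v.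
Proof.
elim: ds v => [|d ds IHds] [|x v] //=.
  by apply/negbTE/negP => /allpairsP [[a b] /= []].
apply/allpairsP/andP => [[[a b] /= [ad bd [-> ->]]]|[xd vd]].
  by rewrite -mem_polys -IHds.
by exists (x, v); rewrite /= mem_polys IHds.
Qed.

Lemma boxlist_uniq ds : uniq (boxlist ds).
Proof.
elim: ds => //= d ds IHds; apply: allpairs_uniq => //; first exact: polys_uniq.
by move=> [a b] [a' b'] _ _ /= [-> ->].
Qed.

Lemma sum_boxlist ds h : \sum_(v <- boxlist ds) h v = q ^+ sumn ds * Ex ds h.
Proof.
elim: ds h => [|d ds IHds] h /=; first by rewrite big_seq1 mul1r.
rewrite big_allpairs_dep exchange_big /= exprD -mulrA -IHds mulr_sumr.
by apply: eq_bigr => v _; rewrite /av mulrC divfK // expf_neq0 ?q_neq0.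
Qed.

End Averages.

(** * Prime divisors in F[t] *)

Section Primes.
Variable F : finFieldType.
Local Notation A := {poly F}.

(** The monic irreducible polynomials: one generator for each nonzero prime ideal. *)
Definition mirr (pi : A) : bool := (pi \is monic) && `[< irreducible_poly pi >].

Lemma mirrP pi : reflect (pi \is monic /\ irreducible_poly pi) (mirr pi).
Proof. by apply: (iffP andP) => -[m /asboolP]. Qed.

Lemma mirr_neq0 pi : mirr pi -> pi != 0.
Proof. by case/mirrP => /monic_neq0. Qed.

Lemma mirr_size pi : mirr pi -> (1 < size pi)%N.
Proof. by case/mirrP => _ []. Qed.

Lemma mirr_prime pi : mirr pi -> prime_elt (pi : A).
Proof.
move=> piP; have pi0 := mirr_neq0 piP; case/mirrP: piP => _ [s1 irr].
split=> //; first by rewrite poly_unitE; case: eqP s1 => [->|].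
move=> a b /dvdpP piab; have [pia|pia] := boolP (pi %| a).
  by left; apply/dvdpP.
right; apply/dvdpP; move: piab; rewrite Gauss_dvdpr //.
rewrite /coprimep; apply/negPn/negP => g1.
have := irr _ g1 (dvdp_gcdl _ _); move/eqp_dvdl => E.
by case/negP: pia; rewrite -E dvdp_gcdr.
Qed.

Lemma mirr_dvd_eq pi rho : mirr pi -> mirr rho -> pi %| rho -> pi = rho.
Proof.
move=> piP rhoP d; have := mirr_size piP.
case/mirrP: piP rhoP => mpi _ /mirrP [mrho [_ irr]] s1.
have /irr : size pi != 1%N by case: eqP s1 => // ->.
by move=> /(_ d); rewrite eqp_monic // => /eqP.
Qed.

Lemma mirr_coprime pi rho : mirr pi -> mirr rho -> pi != rho -> coprimep pi rho.
Proof.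
move=> piP rhoP; apply: contraNT; rewrite /coprimep => g1.
case/mirrP: (piP) => _ [_ irr].
have := irr _ g1 (dvdp_gcdl _ _) => /eqp_dvdl E; apply/eqP.
by apply: mirr_dvd_eq => //; rewrite -E dvdp_gcdr.
Qed.

Lemma prod_mirr_dvd (s : seq A) a : uniq s ->
  (forall x, x \in s -> mirr x /\ x %| a) -> \prod_(x <- s) x %| a.
Proof.
elim: s => [|x s IHs] /=; first by rewrite big_nil dvd1p.
move=> /andP [xs us] h; rewrite big_cons Gauss_dvdp.
  have [_ ->] := h x (mem_head _ _); apply: IHs => // y ys.
  by apply: h; rewrite inE ys orbT.
rewrite big_seq; elim/big_ind: _ => [|y z|y ys]; first exact: coprimep1.
  by rewrite coprimepMr => -> ->.
have [xP _] := h x (mem_head _ _); have [yP _] := h y (mem_behead (s := x ::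
  s) ys).
by apply: mirr_coprime => //; apply: contraNneq xs => ->.
Qed.

Lemma size_prod_mirr (s : seq A) : (forall x, x \in s -> mirr x) ->
  (size s < size (\prod_(x <- s) x)%R)%N.
Proof.
elim: s => [|x s IHs] h; first by rewrite big_nil size_poly1.
have hs y : y \in s -> mirr y by move=> ys; apply: h; rewrite inE ys orbT.
have xP := h x (mem_head _ _); have := mirr_size xP; have := IHs hs.
have P0 : \prod_(y <- s) y != 0 by rewrite -size_poly_gt0; apply:
  leq_ltn_trans (IHs hs).
rewrite big_cons size_mul ?(mirr_neq0 xP) //=.
move: (size (\prod_(y <- s) y)%R) (size s) (size x) => a b c.
by lia.
Qed.

(** For nonzero [a] the bound on the size loses no divisor. For [a = 0] the list is empty, so that
    this case needs separate treatment. *)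
Definition pdivs M (a : A) : seq A :=
  [seq x <- polys F (size a) | [&& mirr x, (M < (size x).-1)%N & x %| a]].

Lemma mem_pdivs M a x : a != 0 ->
  (x \in pdivs M a) = [&& mirr x, (M < (size x).-1)%N & x %| a].
Proof.
move=> a0; rewrite mem_filter mem_polys; case: (boolP (x %| a)) => xa.
  by rewrite dvdp_leq // andbT.
by rewrite !andbF.
Qed.

Lemma pdivs_uniq M a : uniq (pdivs M a).
Proof. by rewrite filter_uniq // polys_uniq. Qed.

(** The product of the distinct prime divisors divides [a], and each contributes at least 1 to its
    degree. *)
Lemma size_pdivs M a : a != 0 -> (size (pdivs M a) <= size a)%N.
Proof.
move=> a0.
have h x : x \in pdivs M a -> mirr x /\ x %| a.
  by rewrite mem_pdivs // => /and3P [].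
apply: ltnW; apply: leq_trans (size_prod_mirr _) _ => [x /h [] //|].
apply: dvdp_leq => //; apply: prod_mirr_dvd => //; exact: pdivs_uniq.
Qed.

Lemma exists_pdiv_large M (a : A) : a != 0 -> (size a <= M)%N ->
  forall x, mirr x -> (M < (size x).-1)%N -> ~~ (x %| a).
Proof.
move=> a0 aM x xP Mx; apply/negP => /(dvdp_leq a0); have := mirr_size xP.
by move: (size x) (size a) aM Mx => b c; lia.
Qed.

End Primes.

(** * Zeros at p-th powers modulo a prime *)

Section RootCount.
Variables (R : realType) (F : finFieldType) (p : nat).
Local Notation A := {poly F}.
Hypothesis pF : p \in [pchar F].
Local Notation q := (#|F|%:R : R).
Local Notation av := (@av R F).

Let pA : p \in [pchar A].
Proof. by rewrite pchar_poly. Qed.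

Lemma subXp (x y : A) : x ^+ p - y ^+ p = (x - y) ^+ p.
Proof. by rewrite -!(pFrobenius_autE pA) rmorphB. Qed.

Lemma p_gt0 : (0 < p)%N.
Proof. exact: prime_gt0 (pcharf_prime pF). Qed.

Lemma pth_power_inj : injective (fun x : A => x ^+ p).
Proof.
move=> x y /= /eqP; rewrite -subr_eq0 subXp expf_eq0 p_gt0 subr_eq0.
by move/eqP.
Qed.

Lemma mirr_dvdX (pi x : A) : mirr pi -> pi %| x ^+ p -> pi %| x.
Proof.
move=> /mirr_prime [_ piU piM] /dvdpP h; apply/dvdpP; move: h.
elim: p => [|m IHm]; last by rewrite exprS => /piM [].
move=> [c /esym c1]; case/negP: piU; apply/unitrP.
by exists c; rewrite [pi * c]mulrC c1 expr0.
Qed.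

(** Distinct polynomials of degree less than that of [pi] are incongruent modulo [pi], and so are
    their p-th powers; hence [divides_coef_of_roots] applies. *)
Lemma count_roots_lt (pi : A) (G : {poly A}) m : mirr pi -> (m < size pi)%N ->
  (exists i, ~~ (pi %| G`_i)) ->
  (count (fun x : A => pi %| G.[x ^+ p])%R (polys F m) < size G)%N.
Proof.
move=> piP mpi [i nd]; rewrite ltnNge; apply/negP => h.
case/negP: nd; apply/dvdpP.
pose rs := [seq x ^+ p | x <- polys F m & pi %| G.[x ^+ p]].
apply: (@divides_coef_of_roots _ pi rs) => //.
- exact: mirr_prime.
- by rewrite map_inj_uniq ?filter_uniq ?polys_uniq //; apply: pth_power_inj.
- move=> _ _ /mapP [x xm ->] /mapP [y ym ->] /dvdpP; rewrite subXp.
  move: xm ym; rewrite !mem_filter !mem_polys => /andP [_ xm] /andP [_ ym].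
  move=> /(mirr_dvdX piP) d; congr (_ ^+ p); apply/eqP; rewrite -subr_eq0.
  apply: contraTT d => xy0; apply/negP => /(dvdp_leq xy0); apply/negP.
  rewrite -ltnNge (leq_ltn_trans _ mpi) // (leq_trans (size_polyD _ _)) //.
  by rewrite size_polyN geq_max xm.
- by move=> _ /mapP [x xm ->]; move: xm; rewrite mem_filter => /andP [/dvdpP].
- by rewrite size_map size_filter.
Qed.

Lemma dvdp_horner_mod (pi x y : A) (G : {poly A}) : pi %| x - y ->
  (pi %| G.[x ^+ p]) = (pi %| G.[y ^+ p]).
Proof.
move=> xy; have : pi %| G.[x ^+ p] - G.[y ^+ p].
  rewrite !horner_coef -sumrB; apply: (big_ind (fun a => pi %| a)) => [|a b|i _].
  - exact: dvdp0.
  - exact: dvdp_add.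
  - rewrite -mulrBr dvdp_mull // -!exprM subrXX dvdp_mulr //.
by move=> h; rewrite -[G.[x ^+ p]](subrK G.[y ^+ p]) dvdp_addr.
Qed.

Lemma av_count d (P : pred A) :
  av d (fun x => (P x)%:R) = (count P (polys F d))%:R / q ^+ d.
Proof.
rewrite /av; congr (_ / _); rewrite -sum1_count natr_sum [RHS]big_mkcond /=.
by apply: eq_bigr => x _; case: (P x).
Qed.

(** If deg pi <= d, the points are equidistributed modulo [pi] and at most [D] of the q^(deg pi)
    classes count. Otherwise the points are pairwise incongruent and at most [D] of the q^d count,
    whence the second term. *)
Lemma av_roots (pi : A) (G : {poly A}) D d : mirr pi ->
  (size G <= D.+1)%N -> (exists i, ~~ (pi %| G`_i)) ->
  av d (fun x : A => (pi %| G.[x ^+ p])%R%:R)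
    <= D%:R * (q^-1 ^+ (size pi).-1 + (d < (size pi).-1)%N%:R * q^-1 ^+ d).
Proof.
move=> piP sG nd; have q0 := q_neq0 R F; have qgt0 := q_gt0 R F.
rewrite av_count; set k := (size pi).-1.
have sk : size pi = k.+1 by rewrite prednK // (ltnW (mirr_size piP)).
have [kd|dk] := leqP k d; last first.
  rewrite mul1r -exprVn; apply: le_trans (_ : D%:R * q^-1 ^+ d <= _).
    apply: ler_wpM2r; first by rewrite exprn_ge0 ?invr_ge0 ?ltW.
    rewrite ler_nat -ltnS.
    by apply: leq_trans sG; apply: count_roots_lt => //; rewrite sk; lia.
  by apply: ler_wpM2l; rewrite ?ler0n // lerDr exprn_ge0 ?invr_ge0 ?ltW.
rewrite mul0r addr0 -av_count (@av_periodic _ _ k _ pi) // => [|x y].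
  rewrite av_count -exprVn; apply: ler_wpM2r.
    by rewrite exprn_ge0 ?invr_ge0 ?ltW.
  rewrite ler_nat -ltnS.
  by apply: leq_trans sG; apply: count_roots_lt => //; rewrite sk.
by congr (nat_of_bool _)%:R; apply: dvdp_horner_mod; rewrite addrK dvdp_mulr.
Qed.

End RootCount.

(** * Estimates for sums over polynomials and for degrees of values *)

Section CommonDivisors.
Variables (R : realType) (F : finFieldType) (p : nat).
Local Notation A := {poly F}.
Local Notation q := (#|F|%:R : R).
Local Notation Q := (q^-1).
Local Notation av := (@av R F).
Local Notation Ex := (@Ex R F).

(** The variables stand for the z_ij and the list for the b_ij, so the values substituted are p-th
    powers. *)
Definition peval n (v : seq A) : {rmorphism ipoly A n -> A} :=
  ieval idfun n [seq x ^+ p | x <- v].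

Lemma Q_ge0 : 0 <= Q.
Proof. by rewrite invr_ge0 ltW ?q_gt0. Qed.

Lemma Q_le_half : Q <= 2^-1.
Proof. by rewrite lef_pV2 ?posrE ?q_gt0 ?q_ge2. Qed.

Lemma QX_ge0 d : 0 <= Q ^+ d.
Proof. by rewrite exprn_ge0 ?Q_ge0. Qed.

Lemma square_le_exp d : (d.+1 ^ 2 <= 4 * 2 ^ d)%N.
Proof.
have [|d3] := ltnP d 3; first by case: d => [|[|[]]].
elim: d d3 => // d IHd; rewrite leq_eqVlt => /orP [/eqP <- //|].
rewrite ltnS => /[dup] d3 /IHd; rewrite expnS !expnS !expn0; nia.
Qed.

Lemma QX_small (C e : R) : 0 <= C -> 0 < e ->
  exists m, forall d, (m <= d)%N -> C * d.+1%:R * Q ^+ d <= e.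
Proof.
(* The threshold makes 4 C / (d + 1) at most [e], and (d + 1) q^-d <= 4 / (d + 1) because (d + 1)^2
   <= 4 * 2^d. *)
move=> C0 e0; exists (Num.bound (4 * C / e)) => d md.
have h : d.+1%:R * Q ^+ d <= 4 / d.+1%:R.
  rewrite ler_pdivlMr ?ltr0Sn // mulrAC -expr2.
  have : Q ^+ d <= (2^-1) ^+ d by rewrite lerXn2r ?nnegrE ?Q_ge0 ?Q_le_half
    ?invr_ge0.
  move=> Qd; apply: le_trans (_ : d.+1%:R ^+ 2 * 2^-1 ^+ d <= _).
    by apply: ler_wpM2l; rewrite ?exprn_ge0 ?ler0n.
  by rewrite exprVn ler_pdivrMr ?exprn_gt0 // -!natrX -natrM ler_nat
    square_le_exp.
rewrite -mulrA; apply: le_trans (ler_wpM2l C0 h) _.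
rewrite mulrA [C * 4]mulrC ler_pdivrMr ?ltr0Sn // [e * _]mulrC -ler_pdivrMr //.
have := archi_boundP (_ : 0 <= 4 * C / e).
rewrite divr_ge0 ?mulr_ge0 ?(ltW e0) // => /(_ isT) /ltW h1.
by apply: le_trans h1 _; rewrite ler_nat (leq_trans md).
Qed.

(** Fewer than q^(k+1) polynomials have degree k, each contributing q^(-2k), so the sum is dominated
    by a geometric series. *)
Lemma sum_polys_tail M d :
  \sum_(x <- polys F d | (M < (size x).-1)%N) Q ^+ (2 * (size x).-1)
    <= 2 * q * Q ^+ M.
Proof.
have q0 := q_gt0 R F; have Q0 := Q_ge0.
(* A sharper bound that passes through the induction on [d]: degree [d] adds at most q Q^d, while 2
   q (Q^d - Q^(d+1)) is at least that since Q <= 1/2. *)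
apply: le_trans (_ : 2 * q * (Q ^+ M - Q ^+ (maxn M d)) <= _); last first.
  by apply: ler_wpM2l; rewrite ?mulr_ge0 ?(ltW q0) // gerBl QX_ge0.
elim: d => [|d IHd].
  rewrite maxn0 subrr mulr0 big_seq_cond big1 // => x; rewrite mem_polys.
  by case: (size x) => //=; rewrite andbF.
rewrite (bigID (fun x : A => size x <= d)%N) /=.
have -> : \sum_(x <- polys F d.+1 | (M < (size x).-1)%N && (size x <= d)%N)
     Q ^+ (2 * (size x).-1)
   = \sum_(x <- polys F d | (M < (size x).-1)%N) Q ^+ (2 * (size x).-1).
  rewrite -big_filter -[RHS]big_filter; apply: perm_big; apply: uniq_perm.
  - by rewrite filter_uniq ?polys_uniq.
  - by rewrite filter_uniq ?polys_uniq.
  by move=> x; rewrite !mem_filter !mem_polys; case: ltnP => //=; lia.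
have [dM|Md] := leqP d M.
  rewrite (maxn_idPl dM) in IHd.
  apply: le_trans (lerD IHd (_ : _ <= 0)) _.
    rewrite big_seq_cond big1 // => x; rewrite mem_polys => /and3P [sx Mx _].
    by exfalso; move: sx Mx dM; clear; move: (size x) => k; lia.
  rewrite subrr mulr0 addr0; apply: mulr_ge0; first by rewrite mulr_ge0 ?(ltW q0).
  rewrite subr_ge0; apply: ler_wiXn2l => //; last exact: leq_maxl.
  by rewrite invf_le1 // (le_trans _ (q_ge2 _ _)) ?ler1n.
rewrite (maxn_idPr (ltnW Md)) in IHd; rewrite (maxn_idPr (leqW (ltnW Md))).
apply: le_trans (lerD IHd (_ : _ <= q * Q ^+ d)) _.
  rewrite big_seq_cond; apply: le_trans
    (_ : \sum_(x <- polys F d.+1) Q ^+ (2 * d) <= _).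
    rewrite [leRHS]big_seq big_mkcond [leRHS]big_mkcond; apply: ler_sum => x _.
    case: ifP => [/and3P [sx _ dx]|_]; last by case: ifP => // _; apply: QX_ge0.
    rewrite sx; rewrite mem_polys in sx; have -> // : (size x).-1 = d.
    by move: sx dx; clear; move: (size x) => k; lia.
  rewrite big_const_seq count_predT iter_addr_0 size_polys.
  rewrite -[leLHS]mulr_natr natrX.
  rewrite mul2n -addnn exprD exprS -mulrA [Q ^+ d * (q * _)]mulrCA -exprMn.
  by rewrite mulVf ?q_neq0 // expr1n mulr1 mulrC.
have h : Q ^+ d.+1 <= 2^-1 * Q ^+ d.
  by rewrite exprS; apply: ler_wpM2r; rewrite ?QX_ge0 ?Q_le_half.
have : 0 <= q * (2^-1 * Q ^+ d - Q ^+ d.+1) by rewrite mulr_ge0 ?(ltW q0) //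
  subr_ge0.
by lra.
Qed.

(** Degrees of values grow at most linearly with [d], which the factor q^-d in the later estimates
    outweighs by [QX_small]. *)
Lemma size_peval n (g : ipoly A n) : exists C, forall d v,
  all (fun x : A => size x <= d)%N v -> (size (peval n v g) <= C * d.+1)%N.
Proof.
elim: n g => [|n IHn] g.
  by exists (size (g : A)) => d v _; rewrite /= leq_pmulr.
elim/poly_ind: (g : {poly ipoly A n}) => [|h c [C hC]].
  by exists 0%N => d v _; rewrite rmorph0 size_poly0.
have [C' hC'] := IHn c; exists (C + p + 1 + C')%N => d v vd.
have vd' : all (fun x : A => size x <= d)%N (behead v) by case: v vd =>
  //= x v /andP [].
have -> : peval n.+1 v (h * 'X + c%:P)
    = peval n.+1 v h * head 0 [seq x ^+ p | x <- v] + peval n (behead v) c.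
  rewrite rmorphD rmorphM /= /horner_eval map_polyX hornerX map_polyC hornerC.
  by rewrite behead_map.
have sx : (size (head 0 [seq x ^+ p | x <- v])%R <= d * p + 1)%N.
  case: v vd {vd'} => [_|x v /= /andP [xd _]]; first by rewrite size_poly0.
  rewrite (leq_trans (size_poly_exp_leq _ _)) // addn1 ltnS leq_mul2r.
  by rewrite (leq_trans (leq_pred _) xd) orbT.
apply: leq_trans (size_polyD _ _) _; rewrite geq_max; apply/andP; split.
  apply: leq_trans (size_polyMleq _ _) _; apply: leq_trans (leq_pred _) _.
  apply: leq_trans (leq_add (hC d v vd) sx) _.
  by rewrite !mulnDl !mulnS; lia.
apply: leq_trans (hC' d _ vd') _.
by rewrite leq_mul2r leq_addl orbT.
Qed.

End CommonDivisors.

Lemma ler_sum_uniq_sub (R : numDomainType) (T : eqType)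
    (s t : seq T) (E : T -> R) :
  uniq s -> {subset s <= t} -> (forall x, x \in t -> 0 <= E x) ->
  \sum_(x <- s) E x <= \sum_(x <- t) E x.
Proof.
elim: s t => [|x s IHs] t /=.
  by move=> _ _ E0; rewrite big_nil big_seq sumr_ge0.
move=> /andP [xs us] st E0; have xt : x \in t by apply: st; rewrite mem_head.
rewrite big_cons (perm_big _ (perm_to_rem xt)) big_cons lerD2l.
apply: IHs => // [y ys|y /mem_rem /E0 //].
have : y \in t by apply: st; rewrite inE ys orbT.
rewrite (perm_mem (perm_to_rem xt)) inE => /orP [/eqP yx|//].
by rewrite -yx ys in xs.
Qed.

(** * The mean weight of the large prime divisors of a value *)

Section CommonDivisors.
Variables (R : realType) (F : finFieldType) (p : nat).
Hypothesis pF : p \in [pchar F].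
Local Notation A := {poly F}.
Local Notation q := (#|F|%:R : R).
Local Notation Q := (q^-1).
Local Notation av := (@av R F).
Local Notation Ex := (@Ex R F).
Local Notation peval := (@peval F p).

Definition weight (x : A) : R := Q ^+ (size x).-1.

(* The value at 0, which every prime divides, is the cap. *)
Definition capped_weight M (a : A) : R :=
  if a == 0 then 1 else Num.min 1 (\sum_(x <- pdivs M a) weight x).

Lemma weight_ge0 x : 0 <= weight x.
Proof. exact: QX_ge0. Qed.

Lemma capped_weight_le1 M a : capped_weight M a <= 1.
Proof. by rewrite /capped_weight; case: ifP => // _; rewrite ge_min lexx. Qed.

Lemma capped_weight_ge0 M a : 0 <= capped_weight M a.
Proof.
by rewrite /capped_weight; case: ifP => // _;
  rewrite le_min ler01 sumr_ge0 // => x _; apply: weight_ge0.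
Qed.

(** To be used with [a] the value of a polynomial and [a1] that of its leading coefficient. The
    primes dividing [a] are split into those dividing [a1], those of degree at least [d], of which
    there are at most [K] with weight at most Q^d, and the rest. The indicator covers [a = 0]; for
    [a1 = 0] the cap already suffices. *)
Lemma capped_weight_step M d K (a a1 : A) : (size a <= K)%N ->
  capped_weight M a <= capped_weight M a1 + ((a1 != 0) && (a == 0))%:R
    + K%:R * Q ^+ d
    + \sum_(x <- polys F d | [&& mirr x, (M < (size x).-1)%N & ~~ (x %| a1)%R])
        weight x * (x %| a)%R%:R.
Proof.
move=> aK; set S := \sum_(x <- polys F d | _) _.
have S0 : 0 <= S by apply: sumr_ge0 => x _; rewrite mulr_ge0 ?weight_ge0.
have KQ : 0 <= K%:R * Q ^+ d :> R by rewrite mulr_ge0 ?QX_ge0.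
have oma := capped_weight_le1 M a.
have [a10|a10] := eqVneq a1 0; first by rewrite {2}/capped_weight a10 eqxx /=;
  lra.
have [a0|a0] := eqVneq a 0; first by have := capped_weight_ge0 M a1;
  rewrite /=; lra.
rewrite /= addr0; rewrite /capped_weight (negPf a0) (negPf a10).
set S1 := \sum_(x <- pdivs M a1) _.
suff h : \sum_(x <- pdivs M a) weight x <= S1 + K%:R * Q ^+ d + S.
  have S10 : 0 <= S1 by apply: sumr_ge0 => x _; apply: weight_ge0.
  case: (leP 1 S1) => S11; rewrite ge_min; apply/orP; [left|right]; last exact: h.
  by lra.
rewrite (bigID (fun x => x %| a1)) /= -addrA; apply: lerD.
  rewrite -big_filter; apply: ler_sum_uniq_sub.
  - by rewrite filter_uniq ?pdivs_uniq.
  - move=> x; rewrite mem_filter !mem_pdivs // => /andP [-> /and3P [-> -> _]] //.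
  - by move=> x _; apply: weight_ge0.
rewrite (bigID (fun x : A => size x <= d)%N) /= addrC; apply: lerD.
  rewrite big_seq_cond; apply: le_trans
    (_ : \sum_(x <- pdivs M a) Q ^+ d <= _).
    rewrite [leRHS]big_seq big_mkcond [leRHS]big_mkcond; apply: ler_sum => x _.
    case: ifP => [/and3P [xa _ dx]|_]; last by case: ifP => // _; apply: QX_ge0.
    rewrite xa /weight; apply: ler_wiXn2l; first exact: Q_ge0.
      by rewrite invf_le1 ?q_gt0 // (le_trans _ (q_ge2 _ _)) ?ler1n.
    by rewrite -ltnNge in dx; move: dx; clear; move: (size x) => k; lia.
  rewrite big_const_seq count_predT iter_addr_0 -[leLHS]mulr_natl.
  apply: ler_wpM2r; first exact: QX_ge0.
  by rewrite ler_nat (leq_trans (size_pdivs _ a0)).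
rewrite -big_filter /S -[leRHS]big_filter; apply: le_trans
    (_ : \sum_(x <- [seq x <- pdivs M a | ~~ (x %| a1) & (size x <= d)%N])
      weight x * (x %| a)%R%:R <= _).
  rewrite big_seq [leRHS]big_seq; apply: ler_sum => x.
  rewrite mem_filter mem_pdivs // => /andP [_ /and3P [_ _ ->]].
  by rewrite mulr1.
apply: ler_sum_uniq_sub.
- by rewrite filter_uniq ?pdivs_uniq.
- move=> x; rewrite !mem_filter mem_polys => /andP [/andP [xa1 sx]].
  by move=> /andP [/and3P [xP Mx _] _]; rewrite xP Mx xa1 mem_polys.
- by move=> x _; rewrite mulr_ge0 ?weight_ge0.
Qed.

Lemma peval_cons n (x : A) v (g : ipoly A n.+1) :
  peval n.+1 (x :: v) g = (map_poly (peval n v) (g : {poly ipoly A n})).[x ^+ p].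
Proof. by []. Qed.

Lemma av_zero (G : {poly A}) D d : (size G <= D.+1)%N -> G != 0 ->
  av d (fun x => (G.[x ^+ p] == 0)%:R) <= D%:R * Q ^+ d.
Proof.
move=> sG G0; rewrite av_count -exprVn; apply: ler_wpM2r; first exact: QX_ge0.
rewrite ler_nat -ltnS; apply: leq_trans sG.
rewrite -size_filter -(size_map (fun x : A => x ^+ p)).
apply: max_poly_roots => //.
  by apply/allP => _ /mapP [x xs ->]; move: xs; rewrite mem_filter => /andP [].
by rewrite map_inj_uniq ?filter_uniq ?polys_uniq //; apply: pth_power_inj.
Qed.

(** [capped_weight_step] is averaged over the outermost variable; [a1] is the coefficient of [G] of
    index [D]. *)
Lemma av_capped_weight n M d v K D (g : ipoly A n.+1) :
  (forall x : A, (size x <= d)%N -> (size (peval n.+1 (x :: v) g) <= K)%N) ->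
  (g : {poly ipoly A n}) != 0 ->
  D = (size (g : {poly ipoly A n})).-1 ->
  av d (fun x => capped_weight M (peval n.+1 (x :: v) g))
    <= capped_weight M (peval n v (lead_coef (g : {poly ipoly A n})))
       + (D + K)%:R * Q ^+ d + D%:R * (2 * q) * Q ^+ M.
Proof.
move=> hK g0 DE; set a1 := peval n v _.
set G := map_poly (peval n v) (g : {poly ipoly A n}).
have sG : (size G <= D.+1)%N by rewrite DE prednK ?size_poly_gt0 ?size_poly.
have GD : G`_D = a1 by rewrite coef_map DE.
apply: le_trans (av_le (fun x xd => capped_weight_step M d a1 (hK x xd))) _.
rewrite !avD !av_const av_sum natrD mulrDl.
have h1 : av d (fun x => ((a1 != 0) && (peval n.+1 (x :: v) g == 0))%:R)
    <= D%:R * Q ^+ d.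
  have [a10|a10] /= := eqVneq a1 0; first by rewrite av_const mulr_ge0 ?QX_ge0.
  apply: av_zero sG _; apply: contraNneq a10 => G0.
  by rewrite -GD G0 coef0.
(* A prime [x] not dividing [a1] leaves [G] nonzero modulo [x], so it divides the value with
   frequency at most D / |x|; with the weight 1 / |x| this gives D times the sum of the |x|^-2. *)
have h2 : \sum_(x <- polys F d | [&& mirr x,
  (M < (size x).-1)%N & ~~ (x %| a1)%R])
     av d (fun y => weight x * (x %| peval n.+1 (y :: v) g)%R%:R)
   <= D%:R * (2 * q) * Q ^+ M.
  have := ler_wpM2l (ler0n R D) (sum_polys_tail R F M d).
  move=> h; rewrite mulrA in h; apply: le_trans h; clear h1.
  rewrite mulr_sumr big_seq_cond big_mkcond [leRHS]big_mkcond.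
  apply: ler_sum => x _.
  case: ifP => [/and4P [xd xP Mx xa1]|_]; last first.
    by case: ifP => // _; rewrite mulr_ge0 ?QX_ge0.
  rewrite Mx avZ mul2n -addnn exprD [leRHS]mulrCA; apply: ler_wpM2l;
    first exact: weight_ge0.
  have := @av_roots R F p pF x G D d xP sG.
  rewrite mem_polys in xd.
  have -> : (d < (size x).-1)%N = false.
    by move: xd; clear; move: (size x) => k; lia.
  by rewrite mul0r addr0; apply; exists D; rewrite GD.
by lra.
Qed.

(** Induction on the number of variables, replacing [g] by its leading coefficient in the outermost
    one. A nonzero constant has no prime divisor of large degree. *)
Lemma Ex_capped_weight_small n (g : ipoly A n) : g != 0 -> forall e : R, 0 < e ->
  exists m, forall M ds, (m <= M)%N -> size ds = n -> sorted geq ds ->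
    all (leq m) ds -> Ex ds (fun v => capped_weight M (peval n v g)) <= e.
Proof.
elim: n g => [|n IHn] g g0 e e0.
  exists (size (g : A)) => M [] // gM _ _ _ /=.
  rewrite /capped_weight (negPf g0) [X in Num.min _ X](_ :
    _ = 0) ?ge_min ?(ltW e0) ?orbT //.
  rewrite big_seq big1 // => x; rewrite mem_pdivs // => /and3P [xP Mx].
  by rewrite (negPf (exists_pdiv_large g0 gM xP Mx)).
have [C hC] := size_peval p g.
have g0' : (g : {poly ipoly A n}) != 0 by [].
have l0 : lead_coef (g : {poly ipoly A n}) != 0 by rewrite lead_coef_eq0.
set D := (size (g : {poly ipoly A n})).-1.
have e3 : 0 < e / 3 by rewrite divr_gt0.
have [m1 h1] := IHn _ l0 _ e3.
have [m2 h2] := QX_small F (ler0n R (D + C)) e3.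
have c0 : 0 <= D%:R * (2 * q) by rewrite !mulr_ge0 ?(ltW (q_gt0 _ _)).
have [m3 h3] := QX_small F c0 e3.
exists (maxn m1 (maxn m2 m3)) => M [//|d ds]; rewrite !geq_max =>
  /and3P [mM1 mM2 mM3].
move=> [sds] srt /= /andP []; rewrite !geq_max => /and3P [md1 md2 md3] ads.
(* The outermost range is the longest, so [d] bounds all coordinates and the degree of the value is
   at most linear in [d]. *)
have ds_le : all (geq d) ds.
  by apply: order_path_min srt => x y z /= h h'; apply: leq_trans h' h.
have srt' : sorted geq ds by apply: path_sorted srt.
apply: le_trans (_ : Ex ds (fun v => capped_weight M (peval n v (lead_coef (g :
  {poly ipoly A n})))
   + ((D + C * d.+1)%:R * Q ^+ d + D%:R * (2 * q) * Q ^+ M)) <= _).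
  apply: Ex_le => v vds; rewrite addrA; apply: av_capped_weight => // x xd;
    apply: hC.
  rewrite /= xd /=; apply/allP => y yv.
  case/inboxP: vds => sv hv; rewrite -(nth_index 0 yv).
  have iy : (index y v < size ds)%N by rewrite -sv index_mem.
  apply: leq_trans (hv _ iy) _; apply: (allP ds_le); exact: mem_nth.
rewrite ExD Ex_const.
have ads1 : all (leq m1) ds.
  by apply: sub_all ads => x; rewrite !geq_max => /and3P [].
have H1 := h1 M ds mM1 sds srt' ads1.
have H2 : (D + C * d.+1)%:R * Q ^+ d <= e / 3.
  apply: le_trans (h2 d md2); apply: ler_wpM2r; first exact: QX_ge0.
  by rewrite -natrM ler_nat mulnDl leq_add2r leq_pmulr.
have H3 : D%:R * (2 * q) * Q ^+ M <= e / 3.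
  apply: le_trans (h3 M mM3); apply: ler_wpM2r; first exact: QX_ge0.
  by rewrite ler_peMr // ler1n.
by lra.
Qed.

End CommonDivisors.

(** * Common prime divisors of values *)

Section NoCommonPrime.
Variable A : idomainType.

(* "Codimension at least 2 over the fraction field of A". *)
Definition no_common_prime n (fs : seq (ipoly A n)) : Prop :=
  (exists2 f, f \in fs & f != 0) /\
  forall g, prime_elt g -> (forall f, f \in fs -> divides g f) ->
    exists c, g = ipolyC A n c.

Definition outer_coefs n (fs : seq (ipoly A n.+1)) : seq (ipoly A n) :=
  flatten [seq polyseq (f : {poly ipoly A n}) | f <- fs].

Lemma outer_coefsP n (fs : seq (ipoly A n.+1)) (c : ipoly A n) :
  reflect (exists2 f : {poly ipoly A n}, f \in fs & c \in (f : seq _))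
    (c \in outer_coefs fs).
Proof.
apply: (iffP flatten_mapP) => -[f fs' cf]; by exists f.
Qed.

(** A prime dividing all the coefficients is, as a constant of the outer ring, a prime dividing all
    of [fs]. *)
Lemma no_common_prime_coefs n (fs : seq (ipoly A n.+1)) :
  no_common_prime fs -> no_common_prime (outer_coefs fs).
Proof.
move=> [[f ffs f0] ncp]; split=> [|g gP gfs].
  exists (lead_coef (f : {poly ipoly A n})); last by rewrite lead_coef_eq0.
  apply/outer_coefsP; exists f => //; rewrite mem_nth //.
  by rewrite ltn_predL size_poly_gt0.
have [c cE] : exists c, g%:P = ipolyC A n.+1 c.
  apply: ncp; first exact: prime_polyC.
  move=> h hfs; apply/divides_polyC => i.
  have [ih|hi] := ltnP i (size (h : {poly ipoly A n})); last first.
    by rewrite nth_default //; apply: divides0.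
  by apply: gfs; apply/outer_coefsP; exists h => //; apply: mem_nth.
by exists c; apply: polyC_inj.
Qed.

(** Elimination of the outermost variable. An element [h] of least degree in the ideal divides each
    member of [fs] up to a nonzero constant. A prime factor of [h] of positive degree does not
    divide that constant, so it would divide all of [fs]. *)
Lemma no_common_prime_elim n (fs : seq (ipoly A n.+1)) : factorial A ->
  no_common_prime fs ->
  exists2 h : ipoly A n, h != 0 & generated fs (h%:P : ipoly A n.+1).
Proof.
move=> facA [[f0 f0fs f00] ncp].
pose J := @generated (ipoly A n.+1) fs.
have JI : is_ideal J := generated_ideal fs.
have [h [Jh h0 hmin]] : exists h : {poly ipoly A n}, [/\ J h, h != 0 &
    forall f : {poly ipoly A n}, J f ->
      exists2 c : ipoly A n, c != 0 & divides h (c *: f)].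
  by apply: ideal_least => //; exists f0 => //; apply: generated_mem.
have [sh|sh] := leqP (size h) 1.
  exists h`_0; first by rewrite -polyC_eq0 -size1_polyC.
  by rewrite -size1_polyC.
have [s [u uU [hE sP]]] := factorial_ipoly (n := n.+1) facA h0.
have [g gs sg] : exists2 g : {poly ipoly A n}, g \in s & (1 < size g)%N.
  apply: contrapT => ns; have : (size h <= 1)%N; last by rewrite leqNgt sh.
  rewrite hE; have u1 : (size (u : {poly ipoly A n}) <= 1)%N.
    by move: uU; rewrite poly_unitE => /andP [/eqP ->].
  have s1 : (size (\prod_(p <- s) (p : {poly ipoly A n}))%R <= 1)%N.
    rewrite big_seq; elim/big_ind: _ => [|a b a1 b1|a as_];
      first by rewrite size_poly1.
      apply: leq_trans (size_polyMleq _ _) _.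
      by move: (size a) (size b) a1 b1 => k l; clear; lia.
    by rewrite leqNgt; apply/negP => a1; apply: ns; exists a.
  apply: leq_trans (size_polyMleq _ _) _.
  move: (size _) s1 => k; move: (size _) u1 => l; clear; lia.
have gh : divides (g : {poly ipoly A n}) h.
  by rewrite hE (perm_big _ (perm_to_rem gs)) big_cons;
    apply/dividesMl/dividesMr/divides_refl.
have gP := sP _ gs.
have [c cE] : exists c, g = ipolyC A n.+1 c.
  apply: ncp => // f ffs; have [c c0 hf] := hmin f (generated_mem ffs).
  have := divides_trans gh hf; rewrite -mul_polyC; case: (gP) =>
    _ _ gM /gM [[k kE]|//].
  exfalso; have k0 : k != 0.
    by apply: contraNneq c0 => k0; rewrite -polyC_eq0 kE k0 mul0r.
  have g0 : g != 0 by case: gP.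
  have := congr1 (size \o polyseq) kE; rewrite /= size_polyC c0 size_mul //.
  have : (0 < size (k : {poly ipoly A n}))%N by rewrite size_poly_gt0.
  by move: (size _) => a; move: (size _) sg => b; clear; lia.
by move: sg; rewrite cE /= ltnNge size_polyC_leq1.
Qed.

End NoCommonPrime.

(** * Rarity of large common prime divisors *)

Section CommonPrimes.
Variables (R : realType) (F : finFieldType) (p : nat).
Hypothesis pF : p \in [pchar F].
Local Notation A := {poly F}.
Local Notation q := (#|F|%:R : R).
Local Notation Q := (q^-1).
Local Notation av := (@av R F).
Local Notation Ex := (@Ex R F).
Local Notation peval := (@peval F p).

Definition common_prime M n (fs : seq (ipoly A n)) (v : seq A) : bool :=
  `[< exists x : A, [/\ mirr x, (M < (size x).-1)%N &
        forall f, f \in fs -> x %| peval n v f] >].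

Lemma bool_le1 (b : bool) : b%:R <= 1 :> R.
Proof. by case: b. Qed.

Lemma generated_peval n (fs : seq (ipoly A n)) (h : ipoly A n) v (x : A) :
  generated fs h -> (forall f, f \in fs -> x %| peval n v f) ->
  x %| peval n v h.
Proof.
move=> /(_ (fun h => x %| peval n v h)) gh xfs; apply: gh => //.
split=> [|c a b xa xb]; first by rewrite rmorph0 dvdp0.
by rewrite rmorphD rmorphM dvdp_add // dvdp_mull.
Qed.

(** A common prime divides the value [a] of [h], which lies in the ideal of [fs]; so for fixed [v]
    there are few candidates, and each is treated by [av_roots]. *)
Lemma av_common_prime n M d K D v (fs : seq (ipoly A n.+1)) (h : ipoly A n) :
  generated fs (h%:P : ipoly A n.+1) -> (0 < D)%N ->
  (forall f, f \in fs -> (size (f : {poly ipoly A n}) <= D)%N) ->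
  (size (peval n v h) <= K)%N ->
  av d (fun x => (common_prime M fs (x :: v))%:R)
    <= (common_prime M (outer_coefs fs) v)%:R
      + D%:R * capped_weight R M (peval n v h)
       + (D * K)%:R * Q ^+ d.
Proof.
move=> gh D0 fsD hK; set a := peval n v h;
  set b := common_prime _ (outer_coefs _) _.
have DK0 : 0 <= (D * K)%:R * Q ^+ d by rewrite mulr_ge0 ?QX_ge0.
have D1 : 1 <= D%:R :> R by rewrite ler1n.
have av1 : av d (fun x => (common_prime M fs (x :: v))%:R) <= 1.
  by rewrite -[leRHS](@av_const R F d); apply: av_le => x _; apply: bool_le1.
have om0 := capped_weight_ge0 R M a.
(* If a large prime divides all the coefficients at [v], or if the cap is reached, the right-hand
   side is at least 1. *)
have [bT|bF] := boolP b.
  have : 0 <= D%:R * capped_weight R M a by rewrite mulr_ge0.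
  by move: av1; rewrite /= mulr1n; lra.
have [omT|] := boolP (1 <= capped_weight R M a).
  have : 1 <= D%:R * capped_weight R M a by rewrite (le_trans D1) // ler_peMr.
  by rewrite /= mulr0n; lra.
rewrite /capped_weight; case: ifP => [|a0]; first by rewrite lexx.
rewrite le_min lexx /= => S1; have {}S1 :
  \sum_(x <- pdivs M a) weight R x < 1 by rewrite ltNge.
rewrite (min_idPr (ltW S1)) mulr0n add0r.
(* Union bound over the large primes dividing [a]. *)
apply: le_trans (_ : av d (fun x => \sum_(y <- pdivs M a)
    `[< forall f, f \in fs -> y %| peval n.+1 (x :: v) f >]%:R) <= _).
  apply: av_le => x _; case: (boolP (common_prime _ _ _)) => [/asboolP|_];
    last first.
    by apply: sumr_ge0.
  move=> [y [yP My yfs]].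
  have ya : y \in pdivs M a.
    rewrite mem_pdivs ?a0 // yP My /=.
    have := generated_peval gh yfs; rewrite /a.
    by rewrite peval_cons map_polyC hornerC.
  rewrite (perm_big _ (perm_to_rem ya)) big_cons; have -> : `[< forall f,
    f \in fs -> y %| peval n.+1 (x :: v) f >].
    by apply/asboolP.
  by rewrite lerDl sumr_ge0.
rewrite av_sum; apply: le_trans
  (_ : \sum_(y <- pdivs M a) D%:R * (weight R y + Q ^+ d) <= _); last first.
  rewrite -mulr_sumr big_split /= mulrDr natrM -mulrA lerD2l.
  apply: ler_wpM2l => //; rewrite big_const_seq count_predT iter_addr_0.
  rewrite -[leLHS]mulr_natl; apply: ler_wpM2r; first exact: QX_ge0.
  by rewrite ler_nat (leq_trans (size_pdivs _ _)) // a0.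
rewrite big_seq [leRHS]big_seq; apply: ler_sum => y.
rewrite mem_pdivs ?a0 // => /and3P [yP My _].
(* As [b] is false, [y] fails to divide some coefficient of some [f], which is therefore nonzero
   modulo [y]. *)
have [f ffs [i nyf]] : exists2 f : {poly ipoly A n}, f \in fs &
    exists i, ~~ (y %| peval n v f`_i).
  apply: contrapT => nE; case/negP: bF; apply/asboolP; exists y; split=> //.
  move=> c /outer_coefsP [f ffs cf]; apply: contrapT => /negP nyc; apply: nE.
  by exists f => //; exists (index c f); rewrite nth_index.
apply: le_trans (_ : av d (fun x =>
  (y %| (map_poly (peval n v) f).[x ^+ p])%R%:R) <= _).
  apply: av_le => x _; rewrite ler_nat; case: asboolP => // /(_ f ffs).
  by rewrite peval_cons => ->.
apply: le_trans (@av_roots R F p pF y _ D d yP _ _) _.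
- by apply: leq_trans (size_poly _ _) (leq_trans (fsD f ffs) (leqnSn _)).
- by exists i; rewrite coef_map.
apply: ler_wpM2l => //; rewrite lerD2l; case: ltnP => _;
  by rewrite ?mul1r ?mul0r ?QX_ge0.
Qed.

(** Of the three terms of [av_common_prime], the first is small by induction, the second by
    [Ex_capped_weight_small] with tolerance e / (3 D), the third by [QX_small]. *)
Lemma Ex_common_prime_small n (fs : seq (ipoly A n)) : no_common_prime fs ->
  forall e : R, 0 < e ->
  exists m, forall M ds, (m <= M)%N -> size ds = n -> sorted geq ds ->
    all (leq m) ds -> Ex ds (fun v => (common_prime M fs v)%:R) <= e.
Proof.
have facA : factorial (A : idomainType) by apply/factorial_poly/factorial_field.
elim: n fs => [|n IHn] fs ncp e e0.
  case: ncp => -[f ffs f0] _.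
  exists (size (f : A)) => M [] // fM _ _ _ /=.
  rewrite /common_prime; case: asboolP => [[x [xP Mx xfs]]|_];
    last by rewrite mulr0n ltW.
  by have := exists_pdiv_large f0 fM xP Mx; rewrite (xfs f ffs).
have ncpc := no_common_prime_coefs ncp.
have [h h0 gh] := no_common_prime_elim facA ncp.
have [C hC] := size_peval p h.
pose D := (\sum_(f <- fs) size (f : {poly ipoly A n})).+1.
have fsD f : f \in fs -> (size (f : {poly ipoly A n}) <= D)%N.
  by move=> ffs; rewrite /D (perm_big _ (perm_to_rem ffs)) big_cons leqW //
    leq_addr.
have D0 : 0 < D%:R :> R by rewrite ltr0Sn.
have e3 : 0 < e / 3 by rewrite divr_gt0.
have [m1 h1] := IHn _ ncpc _ e3.
have [m2 h2] := Ex_capped_weight_small pF h0 (divr_gt0 e3 D0).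
have [m3 h3] := QX_small F (ler0n R (D * C)) e3.
exists (maxn m1 (maxn m2 m3)) => M [//|d ds]; rewrite !geq_max =>
  /and3P [mM1 mM2 mM3].
move=> [sds] srt /= /andP []; rewrite !geq_max => /and3P [md1 md2 md3] ads.
have ds_le : all (geq d) ds.
  by apply: order_path_min srt => x y z /= h4 h5; apply: leq_trans h5 h4.
have srt' : sorted geq ds by apply: path_sorted srt.
apply: le_trans (_ : Ex ds (fun v => ((common_prime M (outer_coefs fs) v)%:R
    + D%:R * capped_weight R M (peval n v h))
      + (D * (C * d.+1))%:R * Q ^+ d) <= _).
  apply: Ex_le => v vds; apply: av_common_prime => //.
  apply: hC; apply/allP => y yv.
  case/inboxP: vds => sv hv; rewrite -(nth_index 0 yv).
  have iy : (index y v < size ds)%N by rewrite -sv index_mem.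
  apply: leq_trans (hv _ iy) _; apply: (allP ds_le); exact: mem_nth.
rewrite !ExD ExZ Ex_const.
have ads1 : all (leq m1) ds.
  by apply: sub_all ads => x; rewrite !geq_max => /and3P [].
have ads2 : all (leq m2) ds.
  by apply: sub_all ads => x; rewrite !geq_max => /and3P [].
have H1 := h1 M ds mM1 sds srt' ads1.
have H2 := h2 M ds mM2 sds srt' ads2.
rewrite ler_pdivlMr // mulrC in H2.
have H3 : (D * (C * d.+1))%:R * Q ^+ d <= e / 3 by rewrite mulnA natrM h3.
by lra.
Qed.

End CommonPrimes.

(** * Components of a polynomial *)

Section Components.
Variables (F : finFieldType) (p : nat).
Hypothesis pF : p \in [pchar F].
Local Notation A := {poly F}.

Lemma finField_pth_root (c : F) : exists d, d ^+ p == c.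
Proof.
have inj : injective (pFrobenius_aut pF) by apply: fmorph_inj.
by exists (invF inj c); rewrite -(pFrobenius_autE pF) f_invF.
Qed.

Definition pth_root (c : F) : F := xchoose (finField_pth_root c).

Lemma pth_rootK c : pth_root c ^+ p = c.
Proof. exact/eqP/(xchooseP (finField_pth_root c)). Qed.

Lemma pth_root0 : pth_root 0 = 0.
Proof.
by apply/eqP; have /eqP := pth_rootK 0; rewrite expf_eq0 => /andP [].
Qed.

(** The b_j in a = \sum_(j < p) t^j b_j^p; [size a] is a generous bound for the number of
    coefficients. *)
Definition component (a : A) (j : nat) : A :=
  \poly_(k < size a) pth_root a`_(k * p + j).

Let p_gt0 : (0 < p)%N := p_gt0 pF.

Lemma componentK (a : A) : \sum_(j < p) 'X^j * component a j ^+ p = a.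
Proof.
apply/polyP => l; rewrite coef_sum.
have E (j : 'I_p) : ('X^j * component a j ^+ p)`_l
    = \sum_(k < size a) a`_l *+ (l == k * p + j)%N.
  rewrite poly_exp_pchar // mulr_sumr coef_sum; apply: eq_bigr => k _.
  rewrite pth_rootK -scalerAr -exprD coefZ coefXn addnC.
  by case: eqP => [->|_]; rewrite ?mulr1 ?mulr0 ?mulr1n ?mulr0n.
under eq_bigr do rewrite E.
have [sl|ls] := leqP (size a) l.
  rewrite nth_default // big1 // => j _.
  by rewrite big1 // => k _; rewrite mul0rn.
have lp : (l %% p < p)%N by rewrite ltn_mod.
have lk : (l %/ p < size a)%N by apply: leq_ltn_trans ls; apply: leq_div.
rewrite (bigD1 (Ordinal lp)) //= (bigD1 (Ordinal lk)) //= -divn_eq eqxx mulr1n.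
rewrite big1 => [|k]; last first.
  rewrite -val_eqE /= => kl; case: eqP => [E'|_ //].
  by case/eqP: kl; rewrite E' divnMDl // (divn_small lp) addn0.
rewrite big1 ?addr0 // => j; rewrite -val_eqE /= => jl.
rewrite big1 // => k _; case: eqP => [E'|_ //].
by case/eqP: jl; rewrite E' modnMDl modn_small.
Qed.

(** For [j < p], the number of exponents less than [d] that are congruent to [j] modulo [p]. *)
Definition comp_size (d j : nat) : nat := d %/ p + (j < d %% p)%N.

Lemma size_component (a : A) d (j : 'I_p) : (size a <= d)%N ->
  (size (component a j) <= comp_size d j)%N.
Proof.
move=> ad; apply/leq_sizeP => k; rewrite /comp_size => dk.
rewrite coef_poly; case: ifP => // _; rewrite nth_default ?pth_root0 //.
apply: leq_trans ad _; rewrite [d in (d <= _)%N](divn_eq d p).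
have rp : (d %% p < p)%N by rewrite ltn_mod.
have [jr|jr] := ltnP j (d %% p); rewrite ?jr ?(ltnNge, jr) /= in dk.
  have : ((d %/ p + 1) * p <= k * p)%N by rewrite leq_mul2r dk orbT.
  by rewrite mulnDl; lia.
rewrite addn0 in dk.
have : (d %/ p * p <= k * p)%N by rewrite leq_mul2r dk orbT.
by lia.
Qed.

Lemma comp_size_ge d (j : nat) : (d %/ p <= comp_size d j)%N.
Proof. exact: leq_addr. Qed.

Lemma sum_comp_size d : (\sum_(j < p) comp_size d j = d)%N.
Proof.
rewrite big_split /= sum_nat_const card_ord [RHS](divn_eq d p) mulnC; congr addn.
rewrite -[LHS]big_mkcond /= -(big_ord_widen p (fun _ =>
  1%N)) ?sum1_card ?card_ord //.
by rewrite ltnW // ltn_mod.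
Qed.

End Components.

Lemma dvdp_sqr_deriv (K : fieldType) (x a : {poly K}) : x ^+ 2 %| a -> x %| a^`().
Proof.
move=> /dvdpP [b ->]; rewrite expr2 mulrA derivM.
by rewrite dvdp_add // ?dvdp_mulIr // mulrAC dvdp_mulIr.
Qed.

(** * Values divisible by the square of a large prime *)

Section Tail.
Variables (R : realType) (F : finFieldType) (p : nat) (n : nat).
Hypothesis pF : p \in [pchar F].
Local Notation A := {poly F}.
Local Notation q := (#|F|%:R : R).
Local Notation Ex := (@Ex R F).
Local Notation I := ('I_n * 'I_p)%type.

Definition eval_list (f : mpoly n A) (v : seq A) : A :=
  meval (fun i : 'I_n => nth 0 v i) f.

Definition square_divisor M (f : mpoly n A) (v : seq A) : bool :=
  `[< exists x : A, [/\ mirr x, (M < (size x).-1)%N & x ^+ 2 %| eval_list f v] >].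

Definition components (s : seq I) (v : seq A) : seq A :=
  [seq component pF (nth 0 v ij.1) ij.2 | ij : I <- s].

Definition comp_sizes (s : seq I) (ds : seq nat) : seq nat :=
  [seq comp_size p (nth 0%N ds ij.1) ij.2 | ij : I <- s].

Section Ordering.
Variable s : seq I.
Hypothesis s_perm : perm_eq s (enum {: I}).

Let s_uniq : uniq s.
Proof. by rewrite (perm_uniq s_perm) enum_uniq. Qed.

Let s_all ij : ij \in s.
Proof. by rewrite (perm_mem s_perm) mem_enum. Qed.

Lemma peval_components (f : mpoly n A) v :
  peval p (size s) (components s v) (jsubst F s f) = eval_list f v.
Proof.
apply: (@mpoly_rmorph_ext n A _
  (peval p (size s) (components s v) \o jsubst F s : {rmorphism _ -> _})
  (meval (fun i : 'I_n => nth 0 v i) : {rmorphism _ -> _})) => [c|i] /=.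
  by rewrite jsubstC ievalC mevalC.
rewrite jsubstX rmorph_sum mevalXU -[RHS](componentK pF); apply: eq_bigr => j _.
rewrite rmorphM ievalC /= /peval -map_comp.
by rewrite (ieval_jvar s_all _ (fun ij => component pF (nth 0 v ij.1) ij.2 ^+ p)).
Qed.

Lemma components_inbox ds v : inbox ds v -> size ds = n ->
  inbox (comp_sizes s ds) (components s v).
Proof.
move=> /inboxP [sv hv] sds; rewrite /inbox /comp_sizes /components.
elim: (s) => //= ij l ->; rewrite andbT; apply: size_component.
by apply: hv; rewrite sds.
Qed.

Lemma components_inj ds : size ds = n ->
  {in boxlist F ds &, injective (components s)}.
Proof.
move=> sds v w; rewrite !mem_boxlist => /inboxP [sv _] /inboxP [sw _] E.
apply: (@eq_from_nth _ 0) => [|k]; first by rewrite sv sw.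
rewrite sv sds => kn.
have h (ij : I) : component pF (nth 0 v ij.1) ij.2 = component pF (nth 0 w
  ij.1) ij.2.
  by move/eq_in_map: E => /(_ ij (s_all ij)).
rewrite -[LHS](componentK pF) -[RHS](componentK pF); apply: eq_bigr => j _.
by rewrite (h (Ordinal kn, j)).
Qed.

Lemma sumn_comp_sizes ds : size ds = n -> sumn (comp_sizes s ds) = sumn ds.
Proof.
move=> sds; rewrite !sumnE big_map (perm_big _ s_perm) big_enum /=.
rewrite -(pair_bigA _ (fun i j => comp_size p (nth 0%N ds (i : 'I_n)) (j :
  'I_p))) /=.
rewrite (big_nth 0%N) sds big_mkord; apply: eq_bigr => i _.
by rewrite (sum_comp_size pF).
Qed.

Lemma square_divisor_common_prime M f v : square_divisor M f v ->
  common_prime p M [:: jsubst F s f;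
    coefwise (@deriv F) (jsubst F s f)] (components s v).
Proof.
move=> /asboolP [x [xP Mx xf]]; apply/asboolP; exists x; split=> // g.
rewrite !inE => /orP [] /eqP ->.
  by rewrite peval_components (dvdp_trans _ xf) // expr2 dvdp_mulr.
rewrite /peval -deriv_ieval; first by rewrite -/(peval p _ _) peval_components
  dvdp_sqr_deriv.
move=> y /mapP [z _ ->]; apply: (derivation_pchar (is_derivation_deriv F)).
by rewrite pchar_poly.
Qed.

(** Taking components maps the box injectively into the box of components. By [sumn_comp_sizes] both
    have the same number of points, so an inequality of counts is one of means. *)
Lemma Ex_square_divisor_le M f ds : size ds = n ->
  Ex ds (fun v => (square_divisor M f v)%:R) <=
  Ex (comp_sizes s ds) (fun w => (common_prime p M
      [:: jsubst F s f; coefwise (@deriv F) (jsubst F s f)] w)%:R).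
Proof.
move=> sds; have q0 : 0 < q ^+ sumn ds by rewrite exprn_gt0 ?q_gt0.
rewrite -(ler_pM2l q0) -sum_boxlist -(sumn_comp_sizes sds) -sum_boxlist.
have E (T : Type) (l : seq T) (P : pred T) :
    \sum_(x <- l) (P x)%:R = (count P l)%:R :> R.
  by rewrite -sum1_count natr_sum [RHS]big_mkcond; apply: eq_bigr => x _; case:
    (P x).
rewrite !E ler_nat -!size_filter -(size_map (components s)).
apply: uniq_leq_size.
  rewrite map_inj_in_uniq ?filter_uniq ?boxlist_uniq // => v w.
  rewrite !mem_filter => /andP [_ vds] /andP [_ wds].
  exact: (components_inj sds).
move=> _ /mapP [v vds ->]; move: vds; rewrite !mem_filter !mem_boxlist.
move=> /andP [/square_divisor_common_prime -> vds] /=.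
exact: components_inbox.
Qed.

End Ordering.

Lemma Ex_square_divisor_small (f : mpoly n A) : f != 0 ->
  (forall g h : mpoly n A, f = g ^+ 2 * h -> exists c, g = mpolyC n c) ->
  forall e : R, 0 < e -> exists m, forall M ds, (m <= M)%N -> size ds = n ->
    all (leq m) ds -> Ex ds (fun v => (square_divisor M f v)%:R) <= e.
Proof.
move=> f0 sqf e e0.
pose fs s := [:: jsubst F s f; coefwise (@deriv F) (jsubst F s f)] :
  seq (ipoly A (size (s : seq I))).
(* The order of the variables depends on the box, but there are only finitely many orders, so one
   threshold serves them all. *)
have [m hm] : exists m, forall s, s \in permutations (enum {: I}) ->
    forall M ds, (m <= M)%N -> size ds = size s -> sorted geq ds ->
    all (leq m) ds -> Ex ds (fun v => (common_prime p M (fs s) v)%:R) <= e.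
  have : forall s, s \in permutations (enum {: I}) -> perm_eq s (enum {: I}).
    by move=> s; rewrite mem_permutations.
  elim: (permutations _) => [|s l IHl] lP; first by exists 0%N.
  have [|m hm] := IHl; first by move=> t tl; apply: lP; rewrite inE tl orbT.
  have sP : perm_eq s (enum {: I}) by apply: lP; rewrite mem_head.
  have s_uniq : uniq s by rewrite (perm_uniq sP) enum_uniq.
  have s_all ij : ij \in s by rewrite (perm_mem sP) mem_enum.
  have ncp : no_common_prime (fs s).
    split=> [|g gP gfs].
      exists (jsubst F s f); first by rewrite mem_head.
      apply: contraNneq f0 => sf0.
      by rewrite -(jsubstK pF s_all f) sf0 rmorph0.
    apply: (jsubst_coprime pF s_all s_uniq _ f0 sqf gP).
    - by move=> c; have [d /eqP dc] := finField_pth_root pF c; exists d.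
    - by apply: gfs; rewrite mem_head.
    - by apply: gfs; rewrite !inE eqxx orbT.
  have [m' hm'] := Ex_common_prime_small pF ncp e0.
  exists (maxn m m') => t; rewrite inE => tl M ds; rewrite geq_max =>
    /andP [mM mM'].
  move=> sds srt ads.
  have ads1 : all (leq m) ds by apply: sub_all ads => x; rewrite geq_max =>
    /andP [].
  have ads2 : all (leq m') ds by apply: sub_all ads => x; rewrite geq_max =>
    /andP [].
  by case/orP: tl => [/eqP ts|tl]; [subst t; apply: hm'|apply: hm].
(* A range of length at least m p leaves at least m for each component. *)
exists (m * p)%N => M ds mM sds ads.
pose r := fun ij kl : I => (comp_size p (nth 0%N ds kl.1) kl.2
                            <= comp_size p (nth 0%N ds ij.1) ij.2)%N.
(* The components are sorted by decreasing length. *)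
pose s := sort r (enum {: I}).
have sP : perm_eq s (enum {: I}) by rewrite perm_sort.
have p0 := p_gt0 pF.
apply: le_trans (Ex_square_divisor_le sP M f sds) _; apply: hm.
- by rewrite mem_permutations.
- by apply: leq_trans mM; rewrite leq_pmulr.
- by rewrite size_map.
- rewrite sorted_map; apply: sort_sorted => a b; exact: leq_total.
- apply/allP => _ /mapP [ij _ ->]; apply: leq_trans (comp_size_ge p _ _).
  rewrite leq_divRL //; apply: (allP ads); apply: mem_nth.
  by rewrite sds.
Qed.

End Tail.

(** * Finitely many primes *)

Section ChineseRemainder.
Variables (R : realType) (F : finFieldType).
Local Notation A := {poly F}.
Local Notation q := (#|F|%:R : R).
Local Notation av := (@av R F).
Local Notation Ex := (@Ex R F).

Definition periodic (N : A) (h : seq A -> R) : Prop :=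
  forall v w, all2 (fun x y => N %| x - y) v w -> h v = h w.

Lemma all2_dvdp_refl (N : A) v : all2 (fun x y => N %| x - y) v v.
Proof. by elim: v => //= x v ->; rewrite subrr dvdp0. Qed.

Lemma periodic_cons N h v (x y : A) : periodic N h -> h (N * y + x ::
  v) = h (x :: v).
Proof.
by move=> hN; apply: hN; rewrite /= addrK dvdp_mulr //= all2_dvdp_refl.
Qed.

Lemma periodic_av N h d : periodic N h -> periodic N (fun v => av d (fun x =>
  h (x :: v))).
Proof.
move=> hN v w vw; apply: eq_av => x _; apply: hN.
by rewrite /= subrr dvdp0.
Qed.

Lemma periodicM N1 N2 h1 h2 : periodic N1 h1 -> periodic N2 h2 ->
  periodic (N1 * N2) (fun v => h1 v * h2 v).
Proof.
move=> p1 p2 v w vw; congr (_ * _).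
  apply: p1; elim: v w vw => [|x v IHv] [|y w] //= /andP [xy /IHv ->].
  by rewrite (dvdp_trans _ xy) ?dvdp_mulr.
apply: p2; elim: v w vw => [|x v IHv] [|y w] //= /andP [xy /IHv ->].
by rewrite (dvdp_trans _ xy) ?dvdp_mull.
Qed.

Lemma Ex_periodic (N : A) a ds h :
  size N = a.+1 -> all (leq a) ds -> periodic N h ->
  Ex ds h = Ex (nseq (size ds) a) h.
Proof.
move=> sN; elim: ds h => //= d ds IHds h /andP [ad ads] hN.
rewrite -IHds //; last exact: periodic_av.
apply: eq_Ex => v _; apply: (av_periodic sN ad) => x y; exact: periodic_cons.
Qed.

(** Writing x = N1 y + r, the value of [h1] depends on [r] only, and for fixed [r] the residue of x
    modulo [N2] runs through all classes as [y] does, because [N1] is invertible modulo [N2]. *)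
Lemma av_CRT (N1 N2 : A) a1 a2 (h1 h2 : A -> R) :
  size N1 = a1.+1 -> size N2 = a2.+1 -> coprimep N1 N2 ->
  (forall x y, N1 %| x - y -> h1 x = h1 y) -> (forall x y,
    N2 %| x - y -> h2 x = h2 y) ->
  av (a1 + a2) (fun x => h1 x * h2 x) = av a1 h1 * av a2 h2.
Proof.
move=> s1 s2 cop p1 p2; rewrite -[LHS]/(_ / _) (sum_polysD _ _ s1) exprD invfM.
rewrite mulrACA; congr (_ * _); rewrite mulr_suml; apply: eq_bigr => r _.
have -> : \sum_(y <- polys F a2) h1 (N1 * y + r) * h2 (N1 * y + r)
    = h1 r * \sum_(y <- polys F a2) h2 (N1 * y + r).
  rewrite mulr_sumr; apply: eq_bigr => y _; congr (_ * _).
  by apply: p1; rewrite addrK dvdp_mulr.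
congr (_ * _).
have N20 : N2 != 0 by rewrite -size_poly_gt0 s2.
pose sg y := (N1 * y + r) %% N2.
have sgE y : h2 (N1 * y + r) = h2 (sg y).
  apply: p2; rewrite /sg [X in X - _](divp_eq _ N2) addrK dvdp_mull //.
under eq_bigr do rewrite sgE.
rewrite -(big_map sg predT h2); apply: perm_big.
have sg_inj : {in polys F a2 &, injective sg}.
  move=> y z; rewrite !mem_polys => ya za E.
  have d : N2 %| N1 * (y - z).
    have -> : N1 * (y - z) = (N1 * y + r) - (N1 * z + r) by ring.
    rewrite [X in _ %| X - _](divp_eq _ N2) [X in _ %| _ - X](divp_eq _ N2).
    by rewrite -/(sg y) -/(sg z) E opprD addrACA subrr addr0 -mulrBl dvdp_mull.
  rewrite Gauss_dvdpr 1?coprimep_sym // in d.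
  apply/eqP; rewrite -subr_eq0; apply: contraTT d => yz0; apply/negP =>
    /(dvdp_leq yz0).
  rewrite s2; apply/negP; rewrite -ltnNge ltnS (leq_trans (size_polyD _ _)) //.
  by rewrite size_polyN geq_max ya.
have u : uniq [seq sg y | y <- polys F a2] by rewrite map_inj_in_uniq ?polys_uniq.
apply: uniq_perm => //; first exact: polys_uniq.
have sub : {subset [seq sg y | y <- polys F a2] <= polys F a2}.
  by move=> _ /mapP [y _ ->]; rewrite mem_polys -ltnS -s2; exact: ltn_modpN0.
have le : (size (polys F a2) <= size [seq sg y | y <- polys F a2])%N by rewrite
  size_map.
by have [] := uniq_min_size u sub le.
Qed.

Lemma Ex_CRT n (N1 N2 : A) a1 a2 (h1 h2 : seq A -> R) :
  size N1 = a1.+1 -> size N2 = a2.+1 -> coprimep N1 N2 ->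
  periodic N1 h1 -> periodic N2 h2 ->
  Ex (nseq n (a1 + a2)%N) (fun x => h1 x * h2 x)
    = Ex (nseq n a1) h1 * Ex (nseq n a2) h2.
Proof.
move=> s1 s2 cop; elim: n h1 h2 => //= n IHn h1 h2 p1 p2.
rewrite -(IHn (fun v => av a1 (fun x => h1 (x :: v))) (fun v => av a2 (fun x =>
  h2 (x :: v)))).
- apply: eq_Ex => v _; apply: (av_CRT s1 s2 cop) => x y xy; [apply: p1|apply: p2];
  by rewrite /= xy all2_dvdp_refl.
- exact: periodic_av.
- exact: periodic_av.
Qed.

Variables (n : nat) (f : mpoly n A).

Lemma dvdp_meval (N : A) (v w : 'I_n -> A) : (forall i, N %| v i - w i) ->
  N %| meval v f - meval w f.
Proof.
move=> vw; rewrite !mevalE -sumrB.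
apply: (big_ind (fun a => N %| a)); [exact: dvdp0|move=> a b; exact: dvdp_add|].
move=> m _; rewrite -mulrBr dvdp_mull //.
apply: (big_ind2 (fun a b => N %| a - b)) => [|a a' b b' aa bb|i _].
- by rewrite subrr dvdp0.
- have -> : a * b - a' * b' = (a - a') * b + a' * (b - b') by ring.
  by apply: dvdp_add; [apply: dvdp_mulr|apply: dvdp_mull].
- by rewrite subrXX dvdp_mulr.
Qed.

Definition sqf_at (x : A) (v : seq A) : R := (~~ (x ^+ 2 %| eval_list f v))%R%:R.

Lemma sqf_at_periodic x : periodic (x ^+ 2) (sqf_at x).
Proof.
move=> v w vw; rewrite /sqf_at; congr (nat_of_bool (~~ _))%:R.
have h i : x ^+ 2 %| nth 0 v i - nth 0 w i.
  elim: v w vw i => [|y v IHv] [|z w] //=; first by move=> _ i;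
    rewrite subrr dvdp0.
  by move=> /andP [yz vw] [|i] //=; apply: IHv.
have d := dvdp_meval (fun i : 'I_n => h i).
by rewrite -[eval_list f v](subrK (eval_list f w)) dvdp_addr.
Qed.

Lemma size_mirr_sqr (x : A) : mirr x -> size (x ^+ 2) = (2 * (size x).-1).+1.
Proof.
move=> /mirr_size sx; have x0 : x != 0 by rewrite -size_poly_gt0 ltnW.
rewrite expr2 size_mul //; move: (size x) sx => k; lia.
Qed.

Lemma Ex_prod_sqf_at (s : seq A) ds : uniq s -> (forall x, x \in s -> mirr x) ->
  size ds = n -> all (leq (\sum_(x <- s) 2 * (size x).-1)) ds ->
  Ex ds (fun v => \prod_(x <- s) sqf_at x v)
    = \prod_(x <- s) Ex (nseq n (2 * (size x).-1)%N) (sqf_at x).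
Proof.
have hN (t : seq A) : uniq t -> (forall x, x \in t -> mirr x) ->
    size (\prod_(x <- t) x ^+ 2) = (\sum_(x <- t) 2 * (size x).-1).+1
    /\ periodic (\prod_(x <- t) x ^+ 2) (fun v => \prod_(x <- t) sqf_at x v).
  elim: t => [|x t IHt] /=; first by rewrite !big_nil size_poly1;
    split=> // v w _; rewrite !big_nil.
  move=> /andP [_ ut] h; have [s1 p1] := IHt ut (fun y yt =>
    h y (mem_behead (s := x :: t) yt)).
  have xP := h x (mem_head _ _); have sx := size_mirr_sqr xP.
  split.
    rewrite !big_cons size_mul; first by rewrite sx s1 addSn addnS.
      by rewrite -size_poly_gt0 sx.
    by rewrite -size_poly_gt0 s1.
  rewrite big_cons; move=> v w vw; rewrite !big_cons.
  exact: (periodicM (@sqf_at_periodic x) p1 vw).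
elim: s ds => [|x s IHs] ds /=.
  move=> _ _ sds _; rewrite big_nil -[RHS](@Ex_const R F ds); apply: eq_Ex => v _.
  by rewrite big_nil.
move=> /andP [xs us] h sds ads.
have hs y : y \in s -> mirr y by move=> ys; apply: h; rewrite inE ys orbT.
have xP := h x (mem_head _ _); have sx := size_mirr_sqr xP.
have [s1 p1] := hN s us hs.
have uxs : uniq (x :: s) by rewrite /= xs.
have [sN pN] := hN (x :: s) uxs h.
(* The box is cut down to residues modulo the product of the squares, so that its side is the sum of
   the two degrees required by [Ex_CRT]. *)
rewrite (Ex_periodic sN ads pN) sds !big_cons.
rewrite (@eq_Ex R F _ _ (fun v => sqf_at x v * \prod_(y <- s) sqf_at y v));
  last by move=> v _; rewrite big_cons.
rewrite (Ex_CRT n sx s1) //; last exact: sqf_at_periodic.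
  by rewrite IHs ?size_nseq // all_nseq leqnn orbT.
rewrite big_seq; elim/big_ind: _ => [|y z|y ys]; first exact: coprimep1.
  by rewrite coprimepMr => -> ->.
apply/coprimep_expl/coprimep_expr/mirr_coprime => //; first exact: hs.
by apply: contraNneq xs => ->.
Qed.

End ChineseRemainder.

(** * Ideals and boxes of F[t] *)

(** An enumeration without repetition also supplies the finiteness on which the meaning of
    [fset_set] depends. *)
Lemma card_fset_set_seq (T : choiceType) (X : set T) (s : seq T) :
  uniq s -> (forall x, X x <-> x \in s) -> #|` fset_set X| = size s.
Proof.
move=> us Xs; have fX : finite_set X.
  have -> : X = [set` s] by apply/seteqP; split=> x /Xs.
  exact: finite_seq.
apply: perm_size; apply: uniq_perm => // x.
rewrite in_fset_set //; apply/idP/idP; rewrite inE; first by move/Xs.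
by move=> xs; apply/Xs.
Qed.

Section Ideals.
Variable F : finFieldType.
Local Notation A := {poly F}.
Implicit Types (a x y pi N : A).

Lemma principal_idealP N a : principal_ideal N a <-> N %| a.
Proof.
split=> [[x _ <-]|/dvdpP [x ->]]; first exact: dvdp_mulIl.
by exists x => //; rewrite mulrC.
Qed.

Lemma principal_ideal_sqr N a : ideal_sqr (principal_ideal N) a <-> N ^+ 2 %| a.
Proof.
split=> [[s [sI ->]]|/dvdpP [x ->]].
  rewrite big_seq; apply: (big_ind (fun b => N ^+ 2 %| b)); first exact: dvdp0.
    by move=> b c; apply: dvdp_add.
  move=> u /sI [/principal_idealP u1 /principal_idealP u2].
  by rewrite expr2 dvdp_mul.
exists [:: (x * N, N)]; split; last by rewrite big_seq1 expr2 mulrA.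
move=> u; rewrite inE => /eqP -> /=; split; apply/principal_idealP => //.
exact: dvdp_mulIr.
Qed.

Lemma coset_principal N x y :
  coset_mod (principal_ideal N) x = coset_mod (principal_ideal N) y <-> N %| x
    - y.
Proof.
split=> [E|xy].
  have : coset_mod (principal_ideal N) y x.
    by rewrite -E /coset_mod /=; apply/principal_idealP; rewrite subrr dvdp0.
  by move/principal_idealP.
apply/seteqP; split=> z /principal_idealP zx; apply/principal_idealP.
  by rewrite -(subrK x z) -addrA dvdp_add.
by rewrite -(subrK y z) -addrA dvdp_add // -opprB dvdpNr.
Qed.

Lemma quotient_card_principal N : N != 0 ->
  quotient_card (principal_ideal N) = (#|F| ^ (size N).-1)%N.
Proof.
move=> N0; have sN : (size N).-1.+1 = size N by rewrite prednK ?size_poly_gt0.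
rewrite -size_polys -(size_map (coset_mod (principal_ideal N))).
apply: card_fset_set_seq.
  rewrite map_inj_in_uniq ?polys_uniq // => x y; rewrite !mem_polys => sx sy.
  move/coset_principal => d; apply/eqP; rewrite -subr_eq0.
  apply: contraTT d => xy0; apply/negP => /(dvdp_leq xy0); apply/negP.
  by rewrite -ltnNge -sN ltnS (leq_trans (size_polyD _ _)) // size_polyN
    geq_max sx.
move=> X; split=> [[x _ <-]|/mapP [x _ ->]]; last by exists x.
apply/mapP; exists (x %% N); first by rewrite mem_polys -ltnS sN ltn_modp.
by apply/coset_principal; rewrite [X in X - _](divp_eq x N) addrK dvdp_mulIr.
Qed.

Lemma abs_cardE a : abs_card a = if a == 0 then 0%N else (#|F| ^ (size a).-1)%N.
Proof. by rewrite /abs_card; case: eqP => // /eqP; apply: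
  quotient_card_principal. Qed.

Lemma mirr_nonzero_prime pi : mirr pi -> nonzero_prime (principal_ideal pi).
Proof.
move=> piP; have [pi0 piU piM] := mirr_prime piP.
have E x : (x \in principal_ideal pi) = (pi %| x).
  by apply/idP/idP; rewrite inE => /principal_idealP.
split=> [|u v|].
- split=> [||a u v].
  + by rewrite (E 0) dvdp0.
  + by rewrite (E 1) dvdp1 gtn_eqF // mirr_size.
  + by rewrite (E u) (E v) (E (a * u + v)) => pu pv;
    rewrite dvdp_add // dvdp_mull.
- rewrite (E u) (E v) (E (u * v)) => /dvdpP /piM [] /dvdpP ->; by rewrite ?orbT.
apply/negP => /eqP E0; case/eqP: pi0.
suff : principal_ideal pi pi by rewrite E0.
exact/principal_idealP/dvdpp.
Qed.

(** An element of least degree generates the ideal, since the constants produced by [ideal_least]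
    are units of F; it is then made monic. *)
Lemma nonzero_prime_principal (P : set A) : nonzero_prime P ->
  exists2 pi, mirr pi & P = principal_ideal pi.
Proof.
move=> [[P0 P1 PD] PM Pn0].
have PE x : (x \in mem P) = (x \in P) by [].
have [f0 Pf0 f00] : exists2 f0, P f0 & f0 != 0.
  apply: contrapT => nE; case/negP: Pn0; apply/eqP/seteqP; split=> [x Px|x ->] /=.
    by apply: contrapT => /eqP x0; apply: nE; exists x.
  by move: P0; rewrite PE inE.
have JI : is_ideal P.
  split=> [|c a b Pa Pb]; first by move: P0; rewrite PE inE.
  by have := PD c a b; rewrite !PE !inE; apply.
have [h [Ph h0 hmin]] := ideal_least JI (ex_intro2 _ _ f0 Pf0 f00).
have hdiv x : P x <-> h %| x.
  split=> [/hmin [c c0 /dvdpP]|/dvdpP [y ->]]; first by rewrite dvdpZr.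
  by case: JI => Z D; rewrite -[y * h]addr0; apply: D.
pose pi := (lead_coef h)^-1 *: h.
have l0 : (lead_coef h)^-1 != 0 by rewrite invr_eq0 lead_coef_eq0.
have pidiv x : P x <-> pi %| x by rewrite dvdpZl.
exists pi; last first.
  by apply/seteqP; split=> x;
    [move/pidiv/principal_idealP|move/principal_idealP/pidiv].
have pi0 : pi != 0 by rewrite scaler_eq0 negb_or l0.
apply/mirrP; split; first by rewrite monicE lead_coefZ mulVf // lead_coef_eq0.
have s1 : size pi != 1%N.
  apply: contra P1 => s1; rewrite PE inE; apply/pidiv.
  by rewrite dvdp1.
split=> [|u su upi].
  by rewrite ltn_neqAle eq_sym s1 size_poly_gt0.
have [v piE] := dvdpP _ _ upi.
have v0 : v != 0 by apply: contraNneq pi0 => v0; rewrite piE v0 mul0r.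
have u0 : u != 0 by apply: contraNneq pi0 => u0; rewrite piE u0 mulr0.
have : (v \in mem P) || (u \in mem P).
  by apply: PM; rewrite PE inE; apply/pidiv; rewrite -piE.
case/orP; rewrite PE inE => /pidiv; last by rewrite /eqp upi.
move=> /(dvdp_leq v0); rewrite piE size_mul //.
move: su; rewrite -size_poly_gt0 in u0; rewrite -size_poly_gt0 in v0.
by move: (size u) (size v) u0 v0 => k l; clear; lia.
Qed.

End Ideals.

(** * Counting points of boxes and zeros modulo an ideal *)

Section Boxes.
Variables (R : realType) (F : finFieldType) (n : nat).
Local Notation A := {poly F}.
Local Notation q := (#|F|%:R : R).
Local Notation Ex := (@Ex R F).

(** A bound on |a| is a bound on the degree of a. The second clause makes [d] tend to infinity with
    [b]. *)
Lemma exists_box_degree (b : R) : 0 <= b -> exists d : nat,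
  (forall a : A, ((abs_card a)%:R <= b) = (size a <= d)%N)
  /\ (forall m, q ^+ m <= b -> (m <= d)%N).
Proof.
move=> b0.
pose P s := (s == 0%N) || (q ^+ s.-1 <= b).
have q1 : 1 <= q by apply: le_trans (q_ge2 R F); rewrite ler1n.
have Pdown s t : (s <= t)%N -> P t -> P s.
  rewrite /P => st /orP [/eqP t0|tb]; first by rewrite t0 leqn0 in st; rewrite st.
  case: s st => // s st /=; apply: le_trans tb; apply: ler_weXn2l => //.
  by case: t st.
have P0 : exists s, P s by exists 0%N.
have Pub s : P s -> (s <= (Num.bound b).+1)%N.
  case: s => // s /=; rewrite /P /= => sb.
  have h1 : (s%:R : R) <= q ^+ s.
    apply: le_trans (_ : (2 ^ s)%:R <= _);
      first by rewrite ler_nat ltnW // ltn_expl.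
    by rewrite natrX lerXn2r ?nnegrE ?(ltW (q_gt0 _ _)) ?q_ge2.
  have := archi_boundP b0; have := le_trans h1 sb => h2 h3.
  by have := le_lt_trans h2 h3; rewrite ltr_nat => /ltnW.
case: (ex_maxnP P0 Pub) => d Pd dmax; exists d; split=> [a|m mb].
  have -> : ((abs_card a)%:R <= b) = P (size a).
    rewrite abs_cardE /P size_poly_eq0; case: eqP => //= _.
    by rewrite natrX.
  by apply/idP/idP => [/dmax|/Pdown]; last exact.
by apply: leq_trans (dmax m.+1 _); rewrite // /P /= mb.
Qed.

Definition ffun_of_list (v : seq A) : {ffun 'I_n -> A} := [ffun i =>
  nth 0 v (i : 'I_n)].

Lemma ffun_of_list_inj ds : size ds = n -> {in boxlist F ds &,
  injective ffun_of_list}.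
Proof.
move=> sds v w; rewrite !mem_boxlist => /inboxP [sv _] /inboxP [sw _] /ffunP E.
apply: (@eq_from_nth _ 0) => [|k]; first by rewrite sv sw.
by rewrite sv sds => kn; have := E (Ordinal kn); rewrite !ffunE.
Qed.

Lemma meval_ffun_of_list (f : mpoly n A) v :
  meval (ffun_of_list v) f = eval_list f v.
Proof. by apply: meval_eq => i; rewrite ffunE. Qed.

Lemma card_box (X : set {ffun 'I_n -> A}) (ds : seq nat) : size ds = n ->
  (#|` fset_set (X `&` [set a : {ffun 'I_n -> A} | forall i,
    (size (a i) <= nth 0 ds i)%N])|%:R : R)
  = q ^+ sumn ds * Ex ds (fun v => `[< X (ffun_of_list v) >]%:R).
Proof.
move=> sds; rewrite -sum_boxlist.
pose l := [seq ffun_of_list v | v <- boxlist F ds & `[< X (ffun_of_list v) >]].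
rewrite (@card_fset_set_seq _ _ l).
- rewrite size_map size_filter -sum1_count natr_sum big_mkcond /=.
  by apply: eq_bigr => v _; case: asbool.
- rewrite map_inj_in_uniq ?filter_uniq ?boxlist_uniq // => v w.
  rewrite !mem_filter => /andP [_ vds] /andP [_ wds]; exact:
    ffun_of_list_inj sds _ _ vds wds.
move=> a; split=> [[Xa ads]|/mapP [v]].
  apply/mapP; exists [seq a i | i <- enum 'I_n]; last first.
    apply/ffunP => i; rewrite ffunE (nth_map i) ?size_enum_ord //.
    by rewrite nth_ord_enum.
  have E : ffun_of_list [seq a i | i <- enum 'I_n] = a.
    apply/ffunP => i; rewrite ffunE (nth_map i) ?size_enum_ord //.
    by rewrite nth_ord_enum.
  rewrite mem_filter mem_boxlist E; apply/andP; split; first exact/asboolP.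
  apply/inboxP; rewrite size_map size_enum_ord sds; split=> // i in_.
  rewrite (nth_map (Ordinal in_)) ?size_enum_ord //.
  have -> : nth (Ordinal in_) (enum 'I_n) i = Ordinal in_.
    by apply: val_inj; rewrite /= nth_enum_ord.
  exact: (ads (Ordinal in_)).
rewrite mem_filter mem_boxlist => /andP [/asboolP Xv /inboxP [sv hv]] ->.
by split=> // i; rewrite ffunE hv // sds.
Qed.

Variable f : mpoly n A.

Lemma root_count_principal (N : A) a : size N = a.+1 ->
  root_count f (principal_ideal N)
  = count (fun v => N %| eval_list f v)%R (boxlist F (nseq n a)).
Proof.
move=> sN; have N0 : N != 0 by rewrite -size_poly_gt0 sN.
pose cl (v : seq A) : {ffun 'I_n -> set A} :=
  [ffun i => coset_mod (principal_ideal N) (nth 0 v (i : 'I_n))].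
rewrite -size_filter -(size_map cl).
apply: card_fset_set_seq.
  rewrite map_inj_in_uniq ?filter_uniq ?boxlist_uniq // => v w.
  rewrite !mem_filter !mem_boxlist =>
    /andP [_ /inboxP [sv hv]] /andP [_ /inboxP [sw hw]].
  move=> /ffunP E; apply: (@eq_from_nth _ 0) => [|k]; first by rewrite sv sw.
  rewrite sv size_nseq => kn; have := E (Ordinal kn); rewrite !ffunE /=.
  move/coset_principal => d; apply/eqP; rewrite -subr_eq0.
  rewrite size_nseq in hv hw; have := hv k kn; have := hw k kn;
    rewrite nth_nseq kn => hwk hvk.
  apply: contraTT d => xy0; apply/negP => /(dvdp_leq xy0); apply/negP.
  by rewrite -ltnNge sN ltnS (leq_trans (size_polyD _ _)) // size_polyN geq_max
    hvk.
move=> X; split=> [[a0 [Xa /coset_principal]]|/mapP [v]].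
  rewrite subr0 => Nf.
  have H i : N %| a0 i %% N - a0 i.
    by rewrite [X in _ - X](divp_eq _ N) opprD addrCA subrr addr0 dvdpNr
      dvdp_mulIr.
  apply/mapP; exists [seq a0 i %% N | i <- enum 'I_n]; last first.
    apply/ffunP => i; rewrite ffunE Xa (nth_map i) ?size_enum_ord // nth_ord_enum.
    by apply/coset_principal; rewrite -opprB dvdpNr.
  rewrite mem_filter mem_boxlist; apply/andP; split.
    have d : N %| eval_list f [seq a0 i %% N | i <- enum 'I_n] - meval a0 f.
      apply: dvdp_meval => i; rewrite (nth_map i) ?size_enum_ord //.
      by rewrite nth_ord_enum.
    by rewrite -[eval_list _ _](subrK (meval a0 f)) dvdp_addr.
  apply/inboxP; rewrite size_map size_enum_ord size_nseq; split=> // i in_.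
  rewrite (nth_map (Ordinal in_)) ?size_enum_ord // nth_nseq in_.
  by rewrite -ltnS -sN ltn_modp.
rewrite mem_filter mem_boxlist => /andP [Nf /inboxP [sv hv]] ->.
exists (ffun_of_list v); split=> [i|]; first by rewrite !ffunE.
by apply/coset_principal; rewrite subr0 meval_ffun_of_list.
Qed.

(** The polynomials of degree less than 2 deg pi represent the classes modulo pi^2, so the box on
    the right is a copy of (A/P^2)^n, with |P|^(2n) points. *)
Lemma local_factor_Ex (pi : A) : mirr pi ->
  local_factor R f (principal_ideal pi) = Ex (nseq n (2 * (size pi).-1)%N)
    (sqf_at R f pi).
Proof.
move=> piP; have pi0 := mirr_neq0 piP; have q0 := q_neq0 R F.
set k := (2 * _)%N.
have -> : sqf_at R f pi = (fun v => 1 + (-1) * (pi ^+ 2 %| eval_list f v)%R%:R).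
  apply/funext => v; rewrite /sqf_at; case: (_ %| _) => /=; ring.
rewrite ExD ExZ Ex_const /local_factor mulN1r; congr (_ - _).
have -> : ideal_sqr (principal_ideal pi) = principal_ideal (pi ^+ 2).
  by apply/seteqP; split=> x;
    [move/principal_ideal_sqr/principal_idealP|move/principal_idealP/principal_ideal_sqr].
rewrite (root_count_principal (size_mirr_sqr piP)) quotient_card_principal //.
have S := @sum_boxlist R F (nseq n k) (fun v => (pi ^+ 2 %| eval_list f v)%R%:R).
have E : \sum_(v <- boxlist F (nseq n k)) (pi ^+ 2 %| eval_list f v)%R%:R
   = (count (fun v => pi ^+ 2 %| eval_list f v)%R (boxlist F (nseq n k)))%:R :> R.
  by rewrite -sum1_count natr_sum [RHS]big_mkcond; apply: eq_bigr => x _; case: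
    (_ %| _).
rewrite -E S sumn_nseq natrX -exprM.
have -> : ((size pi).-1 * (2 * n) = k * n)%N by rewrite /k mulnA [(_ * 2)%N]mulnC.
by rewrite mulrC mulKf // expf_neq0.
Qed.

End Boxes.

(** * The density *)

Lemma prod_uniq_sub_le (R : numDomainType) (T : eqType)
    (s t : seq T) (E : T -> R) :
  uniq s -> {subset s <= t} -> (forall x, 0 <= E x <= 1) ->
  \prod_(x <- t) E x <= \prod_(x <- s) E x.
Proof.
elim: s t => [|x s IHs] t /=; first by move=> _ _ E01; rewrite big_nil prodr_ile1.
move=> /andP [xs us] st E01; have xt : x \in t by apply: st; rewrite mem_head.
rewrite big_cons (perm_big _ (perm_to_rem xt)) big_cons /=.
apply: ler_wpM2l; first by case/andP: (E01 x).
apply: IHs => // y ys; have : y \in t by apply: st; rewrite inE ys orbT.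
rewrite (perm_mem (perm_to_rem xt)) inE => /orP [/eqP yx|//].
by rewrite -yx ys in xs.
Qed.

(** * Unordered products of factors between 0 and 1 *)

Section NetProduct.
Variables (R : realType) (T : choiceType) (u : T -> R).
Hypothesis u01 : forall x, 0 <= u x <= 1.

(** Partial products of factors in [0, 1] decrease as the finite set grows, so their limit is their
    infimum. *)
Definition prod_inf : R := inf [set \prod_(i <- s) u i | s in [set: {fset T}]].

Let lb : has_lbound [set \prod_(i <- s) u i | s in [set: {fset T}]].
Proof.
exists 0 => _ [s _ <-]; apply: prodr_ge0 => i _.
by case/andP: (u01 i).
Qed.

Lemma prod_inf_le (s : {fset T}) : prod_inf <= \prod_(i <- s) u i.
Proof. by apply: ge_inf => //; exists s. Qed.

Lemma prod_inf_approx (e : R) : 0 < e -> exists s0 : {fset T},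
  forall s : {fset T}, (s0 `<=` s)%fset ->
  prod_inf <= \prod_(i <- s) u i <= prod_inf + e.
Proof.
move=> e0; have hi : has_inf [set \prod_(i <- s) u i | s in [set: {fset T}]].
  by split=> //; exists (\prod_(i <- fset0) u i); exists fset0.
have [_ [s0 _ <-] /ltW s0e] := inf_adherent e0 hi.
exists s0 => s s0s; rewrite prod_inf_le; apply: le_trans s0e.
apply: prod_uniq_sub_le => //.
by move=> x; apply: (fsubsetP s0s).
Qed.

Lemma has_product_prod_inf : has_product u prod_inf.
Proof.
have FF : Filter (@summability.totally T).
  exact: (@filter_filter _ _ summability.totally_filter).
apply/cvgrPdist_le => e e0; have [s0 h] := prod_inf_approx e0.
exists s0 => // s /= s0s; have /andP [h1 h2] := h s s0s.
by rewrite ler_distlC; apply/andP; split; lra.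
Qed.

End NetProduct.

Global Instance all_pinfty_filter n (R : realType) : Filter (@all_pinfty n R).
Proof.
apply: filter_from_filter; first by exists 0.
move=> M M' _ _; exists (Num.max M M') => // B hB.
by split=> i; apply: le_trans (hB i); rewrite le_max lexx ?orbT.
Qed.

(** Units of K[x] are constants, so a square factor over A is free of the variables; it may still be
    a nonunit of A. The zero polynomial is excluded by 0 = 0^2 * 0. *)
Lemma squarefree_elt_tofrac (B : idomainType) n (f : mpoly n B) :
  squarefree_elt (map_mpoly (@tofrac B) f : mpoly n {fraction B}) ->
  f != 0 /\ forall g h : mpoly n B, f = g ^+ 2 * h -> exists c, g = mpolyC n c.
Proof.
move=> sqf; split=> [|g h fE].
  apply/negP => /eqP f0; have := sqf 0 0; rewrite f0 !rmorph0 mulr0 unitr0.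
  by move=> /(_ erefl).
have : map_mpoly (@tofrac B) g \is a GRing.unit.
  by apply: (sqf _ (map_mpoly (@tofrac B) h)); rewrite fE rmorphM rmorphXn.
move=> /andP [/eqP gC _]; exists (mcoeff mnm0 g); apply/mpolyP => m.
have := congr1 (mcoeff m) gC; rewrite mcoeff_map_mpoly !mcoeffC mcoeff_map_mpoly.
case: eqP => _; first by rewrite !mulr1 => /eqP; rewrite tofrac_eq => /eqP.
by rewrite !mulr0 => /eqP; rewrite tofrac_eq0 => /eqP.
Qed.

(** * Prime ideals and their monic generators *)

Section PrimeIdeals.
Variable F : finFieldType.
Local Notation A := {poly F}.
Local Notation T := (set_type (@nonzero_prime A)).

Lemma exists_prime_gen (P : T) : exists2 pi : A,
  mirr pi & val P = principal_ideal pi.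
Proof. by apply: nonzero_prime_principal; apply: set_valP. Qed.

Definition prime_gen (P : T) : A := s2val (cid2 (exists_prime_gen P)).

Lemma prime_gen_mirr P : mirr (prime_gen P).
Proof. by rewrite /prime_gen; case: cid2. Qed.

Lemma prime_genE P : val P = principal_ideal (prime_gen P).
Proof. by rewrite /prime_gen; case: cid2. Qed.

Lemma prime_gen_inj : injective prime_gen.
Proof. by move=> P P' E; apply: val_inj; rewrite !prime_genE E. Qed.

Lemma prime_gen_surj (pi : A) : mirr pi -> exists P, prime_gen P = pi.
Proof.
move=> piP; have PP := mirr_nonzero_prime piP.
exists (SigSub (mem_set PP) : T); apply: mirr_dvd_eq => //; first exact:
  prime_gen_mirr.
apply/principal_idealP; rewrite -prime_genE.
exact/principal_idealP/dvdpp.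
Qed.

Lemma ideal_squarefreeP (a : A) :
  ideal_squarefree a <-> forall pi, mirr pi -> ~~ (pi ^+ 2 %| a).
Proof.
split=> [h pi piP|h P PP Pa].
  apply/negP => d; apply: (h _ (mirr_nonzero_prime piP)).
  exact/principal_ideal_sqr.
have [pi piP PE] := nonzero_prime_principal PP.
by move: Pa; rewrite PE => /principal_ideal_sqr; apply/negP/h.
Qed.

(** The primes of degree at most [M], complementary to those considered by [square_divisor M]. *)
Definition primes_upto M : {fset T} :=
  fset_set [set P : T | (size (prime_gen P) <= M.+1)%N].

Lemma mem_primes_upto M P : (P \in primes_upto M) = (size (prime_gen P) <=
  M.+1)%N.
Proof.
have fin : finite_set [set P : T | (size (prime_gen P) <= M.+1)%N].
  have -> : [set P : T | (size (prime_gen P) <= M.+1)%N]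
      = prime_gen @^-1` [set` polys F M.+1].
    by apply/seteqP; split=> Q /=; rewrite mem_polys.
  apply: finite_preimage; last exact: finite_seq.
  by move=> ? ? _ _; apply: prime_gen_inj.
by rewrite in_fset_set //; apply/idP/idP; rewrite inE.
Qed.

End PrimeIdeals.

(** * Comparison of the density with the product *)

Section Density.
Variables (R : realType) (F : finFieldType) (n : nat) (f : mpoly n {poly F}).
Local Notation A := {poly F}.
Local Notation T := (set_type (@nonzero_prime A)).
Local Notation Ex := (@Ex R F).
Hypothesis f0 : f != 0.
Hypothesis sqf : forall g h : mpoly n A, f = g ^+ 2 * h -> exists c,
  g = mpolyC n c.

Let lf (P : T) : R := local_factor R f (val P).
Let good (v : seq A) : bool := `[< squarefree_values f (ffun_of_list n v) >].

Lemma local_factor_gen P :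
  lf P = Ex (nseq n (2 * (size (prime_gen P)).-1)%N) (sqf_at R f (prime_gen P)).
Proof. by rewrite /lf prime_genE local_factor_Ex // prime_gen_mirr. Qed.

Lemma sqf_at01 x v : 0 <= sqf_at R f x v <= 1.
Proof. by rewrite /sqf_at; case: (~~ _); rewrite ?lexx ler01. Qed.

Lemma local_factor01 P : 0 <= lf P <= 1.
Proof.
rewrite local_factor_gen; apply/andP; split.
  rewrite -[leLHS](@Ex_const R F (nseq n (2 * (size (prime_gen P)).-1)%N)).
  by apply: Ex_le => v _; case/andP: (sqf_at01 (prime_gen P) v).
rewrite -[leRHS](@Ex_const R F (nseq n (2 * (size (prime_gen P)).-1)%N)).
by apply: Ex_le => v _; case/andP: (sqf_at01 (prime_gen P) v).
Qed.

Lemma goodP v : reflect (forall pi,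
  mirr pi -> ~~ (pi ^+ 2 %| eval_list f v)) (good v).
Proof.
apply: (iffP (asboolP _)); rewrite /squarefree_values /= meval_ffun_of_list.
  by move/ideal_squarefreeP.
by move=> h; apply/ideal_squarefreeP.
Qed.

Lemma good_le_prod (s : {fset T}) v :
  (good v)%:R <= \prod_(P <- s) sqf_at R f (prime_gen P) v.
Proof.
case: goodP => [h|_]; last first.
  by rewrite mulr0n; apply: prodr_ge0 => P _; case/andP:
    (sqf_at01 (prime_gen P) v).
by rewrite big1 // => P _; rewrite /sqf_at h // prime_gen_mirr.
Qed.

(** If pi^2 divides the value, either deg pi <= M and a factor of the product vanishes, or deg pi >
    M and [square_divisor] holds. *)
Lemma prod_le_good M v :
  \prod_(P <- primes_upto F M) sqf_at R f (prime_gen P) v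
    <= (good v)%:R + (square_divisor M f v)%:R.
Proof.
have p1 : \prod_(P <- primes_upto F M) sqf_at R f (prime_gen P) v <= 1.
  by apply: prodr_ile1 => P _; apply: sqf_at01.
case: goodP => [_|/existsNP [pi /not_implyP [piP /negP/negPn d]]].
  by apply: (le_trans p1); rewrite mulr1n lerDl.
rewrite mulr0n add0r; have [sM|Ms] := leqP (size pi) M.+1.
  have [P PE] := prime_gen_surj piP.
  have PM : P \in primes_upto F M by rewrite mem_primes_upto PE.
  by rewrite (perm_big _ (perm_to_rem PM)) big_cons /sqf_at PE d /= mul0r.
suff -> : square_divisor M f v by rewrite mulr1n.
by apply/asboolP; exists pi; split=> //; case: (size pi) Ms.
Qed.

(** The tail estimate is uniform in [M]; only then is the box taken large enough, depending on [M],
    for the Chinese remainder theorem to give the product exactly. *)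
Lemma Ex_good_approx (e : R) : 0 < e -> exists m, forall M, (m <= M)%N ->
  exists D, forall ds, size ds = n -> all (leq D) ds ->
    \prod_(P <- primes_upto F M) lf P - e <= Ex ds (fun v => (good v)%:R)
      <= \prod_(P <- primes_upto F M) lf P.
Proof.
move=> e0; have [p _ pF] := finPcharP F.
have [m hm] := Ex_square_divisor_small (R := R) pF f0 sqf e0.
exists m => M mM; pose l := [seq prime_gen P | P <- primes_upto F M].
exists (maxn m (\sum_(x <- l) 2 * (size x).-1)) => ds sds ads.
have ads1 : all (leq m) ds by apply: sub_all ads => x; rewrite geq_max =>
  /andP [].
have ads2 : all (leq (\sum_(x <- l) 2 * (size x).-1)) ds.
  by apply: sub_all ads => x; rewrite geq_max => /andP [].
have E : \prod_(P <- primes_upto F M) lf P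
    = Ex ds (fun v => \prod_(P <- primes_upto F M) sqf_at R f (prime_gen P) v).
  transitivity (Ex ds (fun v => \prod_(x <- l) sqf_at R f x v)); last first.
    by apply: eq_Ex => v _; rewrite big_map.
  rewrite Ex_prod_sqf_at //.
  - by rewrite big_map; apply: eq_bigr => P _; apply: local_factor_gen.
  - by rewrite map_inj_uniq ?fset_uniq //; apply: prime_gen_inj.
  - by move=> _ /mapP [P _ ->]; apply: prime_gen_mirr.
rewrite E; apply/andP; split; last by apply: Ex_le => v _; apply: good_le_prod.
rewrite lerBlDr; apply: le_trans (lerD (lexx _) (hm M ds mM sds ads1)).
by rewrite -ExD; apply: Ex_le => v _; apply: prod_le_good.
Qed.

Lemma squarefree_values_density : has_density (squarefree_values f) (prod_inf lf).
Proof.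
apply/cvgrPdist_le => e e0.
have [s0 hs0] := prod_inf_approx local_factor01 e0.
have [m hm] := Ex_good_approx e0.
(* [M] is large enough for the tail estimate and for [primes_upto F M] to contain [s0]. *)
pose M := maxn m (\max_(P <- s0) size (prime_gen P)).
have [D hD] := hm M (leq_maxl _ _).
have /hs0 /andP [h1 h2] : (s0 `<=` primes_upto F M)%fset.
  apply/fsubsetP => P Ps0; rewrite mem_primes_upto leqW // leq_max; apply/orP;
    right.
  by rewrite (big_rem P) //= leq_maxl.
(* A bound q^D on the norms forces degree bounds of at least [D]. *)
exists (#|F|%:R ^+ D) => // B /= hB.
have B0 i : 0 <= B i by apply: le_trans (hB i); rewrite exprn_ge0 ?ler0n.
have [d dP] := choice (fun i => exists_box_degree F (B0 i)).
pose ds := [seq d i | i <- enum 'I_n].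
have sds : size ds = n by rewrite size_map size_enum_ord.
have dsE (i : 'I_n) : nth 0%N ds i = d i.
  by rewrite (nth_map i) ?size_enum_ord // nth_ord_enum.
have boxE : box B = [set a : {ffun 'I_n -> A} | forall i,
  (size (a i) <= nth 0 ds i)%N].
  apply/seteqP; split=> a h i; have := h i; case: (dP i) => dE _.
    by rewrite dsE -dE.
  by rewrite dsE /= dE.
have ads : all (leq D) ds.
  by apply/allP => _ /mapP [i _ ->]; case: (dP i) => _; apply.
have q0 : (#|F|%:R : R) ^+ sumn ds != 0 by rewrite expf_neq0 ?q_neq0.
have cT : (#|` fset_set (box B : set {ffun 'I_n -> A})|%:R :
  R) = #|F|%:R ^+ sumn ds.
  rewrite boxE -[X in fset_set X]setTI card_box //.
  rewrite (_ : (fun v => _) = fun _ => 1) ?Ex_const ?mulr1 //.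
  by apply/funext => v; rewrite asboolT.
rewrite cT boxE card_box // mulrAC divff // mul1r.
(* The finite product exceeds the infimum by at most [e] and the mean falls short of the product by
   at most [e]; these errors have opposite signs, so [e] need not be halved. *)
have /andP [h3 h4] := hD ds sds ads.
by rewrite ler_distlC; apply/andP; split; rewrite -/(good _); lra.
Qed.

End Density.

Theorem theorem3p4 (R : realType) (F : finFieldType) (n : nat)
    (f : {mpoly {poly F}[n]})
    (hf : squarefree_elt
            (map_mpoly (@tofrac {poly F}) f
               : {mpoly {fraction {poly F}}[n]})) :
  exists mu : R,
    has_density (squarefree_values f) mu /\
    has_product
      (fun P : set_type (@nonzero_prime {poly F}) => local_factor R f (val P))
      mu.
Proof.
have [f0 sqf] := squarefree_elt_tofrac hf.
exists (prod_inf (fun P : set_type (@nonzero_prime {poly F}) =>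
  local_factor R f (val P))).
split; first exact: squarefree_values_density.
by apply: has_product_prod_inf => P; apply: local_factor01.
Qed.
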